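(* Let $N\ge2$ and $m_i\ge2$ for all $i\in\{1,\dots,N\}$. Suppose Assumptions A1 and A2 hold, the game has a (finite) Nash equilibrium $\mathbf x^*$, and for each $i\in\{1,\dots,N\}$ and $k\in\{1,\dots,m_i\}$ the interference graph $\mathcal G_I^i$ and the interference-to-$k$ communication graph $\mathcal G_{C_k}^i$ are undirected and connected. Then for each pair of positive constants $(\Delta,v)$ there exists $\delta^*(\Delta,v)>0$ such that for each $\delta\in(0,\delta^* )$, every solution of the seeking dynamics with $\|\chi(0)\|<\Delta$ satisfies $$\|\chi(t)\|\le\phi(\|\chi(0)\|,\delta t)+v\quad\text{for all }t\ge0,$$ where $\phi$ is a class-$\mathcal{KL}$ function.
   Context: Let $N\ge1$ and $m_i\ge1$ ($i=1,\dots,N$) be integers. Agent $j$ of coalition $i$ ($j\in\{1,\dots,m_i\}$) has action $x_{ij}\in\mathbb R$; $\mathbf x_i=(x_{i1},\dots,x_{im_i})^T$, $\mathbf x=(\mathbf x_1^T,\dots,\mathbf x_N^T)^T\in\mathbb R^{M}$ with $M=\sum_i m_i$, and $\mathbf x_{-i}$ denotes $\mathbf x$ with block $\mathbf x_i$ removed. Agent $j$ of coalition $i$ has a local cost $f_{ij}:\mathbb R^M\to\mathbb R$, and coalition $i$ has cost $f_i=\sum_{j=1}^{m_i}f_{ij}$. A Nash equilibrium is $\mathbf x^*$ with $f_i(\mathbf x_i^*,\mathbf x_{-i}^* )\le f_i(\mathbf x_i,\mathbf x_{-i}^* )$ for all $\mathbf x_i\in\mathbb R^{m_i}$ and all $i$.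 Pseudo-gradient: $\mathcal P(\mathbf x)=((\partial f_1/\partial\mathbf x_1)^T,\dots,(\partial f_N/\partial\mathbf x_N)^T)^T$. Assumption A1: every $f_{ij}$ is $\mathcal C^2$. Assumption A2: $(\mathbf x-\mathbf y)^T(\mathcal P(\mathbf x)-\mathcal P(\mathbf y))>0$ for all distinct $\mathbf x,\mathbf y\in\mathbb R^M$. Interference graph $\mathcal G_I^i$: the undirected graph on vertex set $\{1,\dots,m_i\}$ in which distinct $j,k$ are adjacent iff $f_{ij}$ depends explicitly on $x_{ik}$ or $f_{ik}$ depends explicitly on $x_{ij}$; $\mathcal N_{Ik}^i$ is the neighbor set of $k$ in $\mathcal G_I^i$ and $N_{Ik}^i=|\mathcal N_{Ik}^i|$. In particular $\partial f_{ij}/\partial x_{ik}\equiv0$ whenever $j\notin\mathcal N_{Ik}^i\cup\{k\}$. Communication graph $\mathcal G_C^i$: an undirected weighted graph on $\{1,\dots,m_i\}$ with adjacency matrix $(a_i^{jl})$, $a_i^{jl}=a_i^{lj}\ge0$, $a_i^{jj}=0$. The interference-to-$k$ communication graph $\mathcal G_{C_k}^i$ is the subgraph of $\mathcal G_C^i$ induced on the vertex set $\mathcal N_{Ik}^i\cup\{k\}$ (with inherited weights); its Laplacian is $L_{C_k}^i$ and its number of vertices is $N_{C_k^i}=N_{Ik}^i+1$. Seeking dynamics: fix $\delta>0$ and positive constants $\bar d_{ij}$, set $d_{ij}=\delta\bar d_{ij}$. For all $i,j$: $\dot x_{ij}=-d_{ij}\,g_{ijj}$, and for each $k\in\mathcal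 N_{Ij}^i\cup\{j\}$: $\dot w_{ijk}=-\sum_{l\in\mathcal N_{Ik}^i\cup\{k\}}a_i^{jl}(g_{ijk}-g_{ilk})$, $g_{ijk}=w_{ijk}+\partial f_{ij}(\mathbf x)/\partial x_{ik}$, with initial conditions $w_{ijk}(0)=0$ and $\mathbf x(0)$ arbitrary. Error coordinates: $G_{ik}$ is the vector of $g_{ijk}$ over $j\in\mathcal N_{Ik}^i\cup\{k\}$; $R_{ik}\in\mathbb R^{N_{C_k^i}\times(N_{C_k^i}-1)}$ is any matrix such that $[\mathbf 1_{N_{C_k^i}}/\sqrt{N_{C_k^i}}\ \ R_{ik}]$ is an orthogonal matrix ($\mathbf 1_n$ the all-ones vector); $\bar G_{ik}=R_{ik}^TG_{ik}$. $\bar G=(\bar G_{11}^T,\dots,\bar G_{1m_1}^T,\bar G_{21}^T,\dots,\bar G_{Nm_N}^T)^T$ and $\chi(t)=(\bar G(t)^T,(\mathbf x(t)-\mathbf x^* )^T)^T$. *)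

(* Defs.v *)
From mathcomp Require Import all_boot.
From Stdlib Require Import Reals ClassicalEpsilon Relation_Operators.

Local Open Scope R_scope.

(* Agent j of coalition i is indexed by i : 'I_N and j : 'I_(m i) (0-based). *)
Definition vec {N : nat} (m : 'I_N -> nat) := forall i : 'I_N, 'I_(m i) -> R.

Definition rsum {n : nat} (F : 'I_n -> R) : R := \big[Rplus/0]_(i < n) F i.

Definition upd {N : nat} {m : 'I_N -> nat} (x : vec m) (a : 'I_N) (b : 'I_(m a)) (t : R) : vec m :=
  fun i j => if (nat_of_ord i == nat_of_ord a) && (nat_of_ord j == nat_of_ord b)
             then t else x i j.

Definition blend {N : nat} {m : 'I_N -> nat} (x : vec m) (i : 'I_N) (y : vec m) : vec m :=
  fun i' j' => if nat_of_ord i' == nat_of_ord i then y i' j' else x i' j'.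

Definition vdiff {N : nat} {m : 'I_N -> nat} (x y : vec m) : vec m := fun i j => x i j - y i j.
Definition sqnorm {N : nat} {m : 'I_N -> nat} (x : vec m) : R :=
  rsum (fun i => rsum (fun j => (x i j) ^ 2)).
Definition vnorm {N : nat} {m : 'I_N -> nat} (x : vec m) : R := sqrt (sqnorm x).

Definition contv {N : nat} {m : 'I_N -> nat} (F : vec m -> R) : Prop :=
  forall x eps, 0 < eps -> exists del, 0 < del /\
    forall y, vnorm (vdiff y x) < del -> Rabs (F y - F x) < eps.

Definition pd {N : nat} {m : 'I_N -> nat} (F : vec m -> R) (a : 'I_N) (b : 'I_(m a)) (x : vec m) (l : R) : Prop :=
  derivable_pt_lim (fun t => F (upd x a b t)) (x a b) l.

Definition C2 {N : nat} {m : 'I_N -> nat} (F : vec m -> R) : Prop :=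
  exists (D1 : forall a : 'I_N, 'I_(m a) -> vec m -> R)
         (D2 : forall a : 'I_N, 'I_(m a) -> forall c : 'I_N, 'I_(m c) -> vec m -> R),
    contv F /\
    (forall a b x, pd F a b x (D1 a b x)) /\
    (forall a b c d x, pd (D1 a b) c d x (D2 a b c d x)) /\
    (forall a b, contv (D1 a b)) /\
    (forall a b c d, contv (D2 a b c d)).

Definition costs {N : nat} (m : 'I_N -> nat) := forall i : 'I_N, 'I_(m i) -> vec m -> R.

Definition AssumptionA1 {N : nat} {m : 'I_N -> nat} (f : costs m) : Prop := forall i j, C2 (f i j).

Definition fc {N : nat} {m : 'I_N -> nat} (f : costs m) (i : 'I_N) (x : vec m) : R :=
  rsum (fun j => f i j x).

Definition pseudo_grad {N : nat} {m : 'I_N -> nat} (f : costs m) (P : vec m -> vec m) : Prop :=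
  forall x i k, pd (fc f i) i k x (P x i k).

Definition inner {N : nat} {m : 'I_N -> nat} (x y : vec m) : R :=
  rsum (fun i => rsum (fun j => x i j * y i j)).

Definition AssumptionA2 {N : nat} {m : 'I_N -> nat} (f : costs m) : Prop :=
  forall P, pseudo_grad f P ->
  forall x y : vec m, (exists i j, x i j <> y i j) ->
    0 < inner (vdiff x y) (vdiff (P x) (P y)).

Definition Nash {N : nat} {m : 'I_N -> nat} (f : costs m) (xs : vec m) : Prop :=
  forall (i : 'I_N) (y : vec m), fc f i xs <= fc f i (blend xs i y).

Definition depends {N : nat} {m : 'I_N -> nat} (F : vec m -> R) (a : 'I_N) (b : 'I_(m a)) : Prop :=
  exists x t, F (upd x a b t) <> F x.

Definition adjI {N : nat} {m : 'I_N -> nat} (f : costs m) (i : 'I_N) (j k : 'I_(m i)) : Prop :=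
  j <> k /\ (depends (f i j) i k \/ depends (f i k) i j).

Definition inS {N : nat} {m : 'I_N -> nat} (f : costs m) (i : 'I_N) (k j : 'I_(m i)) : Prop :=
  j = k \/ adjI f i k j.

Definition connectedI {N : nat} {m : 'I_N -> nat} (f : costs m) (i : 'I_N) : Prop :=
  forall u v, clos_refl_trans _ (adjI f i) u v.

Definition weights {N : nat} (m : 'I_N -> nat) := forall i : 'I_N, 'I_(m i) -> 'I_(m i) -> R.

Definition weights_ok {N : nat} {m : 'I_N -> nat} (a : weights m) : Prop :=
  (forall i j l, a i j l = a i l j) /\ (forall i j l, 0 <= a i j l) /\ (forall i j, a i j j = 0).

Definition connectedCk {N : nat} {m : 'I_N -> nat} (f : costs m) (a : weights m) (i : 'I_N) (k : 'I_(m i)) : Prop :=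
  forall u v, inS f i k u -> inS f i k v ->
    clos_refl_trans _ (fun p q => inS f i k p /\ inS f i k q /\ 0 < a i p q) u v.

Definition ind (P : Prop) : R := if excluded_middle_informative P then 1 else 0.

Definition nS {N : nat} {m : 'I_N -> nat} (f : costs m) (i : 'I_N) (k : 'I_(m i)) : nat :=
  (\sum_(j < m i) (if excluded_middle_informative (inS f i k j) then 1 else 0))%nat.

(* Rm i k j c : entry (j,c) of R_ik, rows j in N_Ik^i \cup {k}, columns c < N_{C_k^i} - 1 *)
Definition Rmats {N : nat} (m : 'I_N -> nat) := forall i : 'I_N, 'I_(m i) -> 'I_(m i) -> nat -> R.

(* [1/sqrt(n) 1, R_ik] is an orthogonal (n x n) matrix, i.e. its columns are orthonormal *)
Definition orthoR {N : nat} {m : 'I_N -> nat} (f : costs m) (Rm : Rmats m) : Prop :=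
  forall i k,
    (forall c c' : nat, (c < nS f i k - 1)%nat -> (c' < nS f i k - 1)%nat ->
       rsum (fun j => ind (inS f i k j) * Rm i k j c * Rm i k j c') = (if c == c' then 1 else 0)) /\
    (forall c : nat, (c < nS f i k - 1)%nat ->
       rsum (fun j => ind (inS f i k j) * Rm i k j c) = 0).

Definition gvals {N : nat} (m : 'I_N -> nat) := forall i : 'I_N, 'I_(m i) -> 'I_(m i) -> R.

(* ||chi||, chi = (Gbar, x - xstar) *)
Definition chinorm {N : nat} {m : 'I_N -> nat} (f : costs m) (Rm : Rmats m) (G : gvals m) (x xs : vec m) : R :=
  sqrt (rsum (fun i => rsum (fun k =>
          \big[Rplus/0]_(c < nS f i k - 1)
             (rsum (fun j => ind (inS f i k j) * Rm i k j c * G i j k)) ^ 2))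
        + sqnorm (vdiff x xs)).

Definition dercost {N : nat} (m : 'I_N -> nat) := forall i : 'I_N, 'I_(m i) -> 'I_(m i) -> vec m -> R.

(* g_ijk(t) = w_ijk(t) + d f_ij / d x_ik (x(t)) *)
Definition gof {N : nat} {m : 'I_N -> nat} (df : dercost m) (x : R -> vec m) (w : R -> gvals m) (t : R) : gvals m :=
  fun i j k => w t i j k + df i j k (x t).

Definition rcont0 (h : R -> R) : Prop :=
  forall eps, 0 < eps -> exists del, 0 < del /\ forall s, 0 <= s < del -> Rabs (h s - h 0) < eps.

Definition solution {N : nat} {m : 'I_N -> nat} (f : costs m) (df : dercost m) (a : weights m)
    (d : vec m) (x : R -> vec m) (w : R -> gvals m) : Prop :=
  let g := gof df x w in
  (forall i j k, inS f i k j -> w 0 i j k = 0) /\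
  (forall i j, rcont0 (fun s => x s i j)) /\
  (forall i j k, inS f i k j -> rcont0 (fun s => w s i j k)) /\
  (forall t, 0 < t -> forall i j,
      derivable_pt_lim (fun s => x s i j) t (- d i j * g t i j j)) /\
  (forall t, 0 < t -> forall i j k, inS f i k j ->
      derivable_pt_lim (fun s => w s i j k) t
        (- rsum (fun l => ind (inS f i k l) * a i j l * (g t i j k - g t i l k)))).

Definition classK (al : R -> R) : Prop :=
  al 0 = 0 /\
  (forall r, 0 <= r -> forall eps, 0 < eps -> exists del, 0 < del /\
      forall r', 0 <= r' -> Rabs (r' - r) < del -> Rabs (al r' - al r) < eps) /\
  (forall r1 r2, 0 <= r1 -> r1 < r2 -> al r1 < al r2).

Definition classKL (phi : R -> R -> R) : Prop :=
  (forall s, 0 <= s -> classK (fun r => phi r s)) /\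
  (forall r, 0 <= r ->
     (forall s1 s2, 0 <= s1 -> s1 <= s2 -> phi r s2 <= phi r s1) /\
     (forall eps, 0 < eps -> exists S, forall s, S <= s -> Rabs (phi r s) < eps)).

(* Main.v *)
From mathcomp Require Import all_boot all_algebra Rstruct.
From Stdlib Require Import Reals ClassicalEpsilon Relation_Operators.
From Stdlib Require Import FunctionalExtensionality IndefiniteDescription Lra.
From Coquelicot Require Import Coquelicot.
Require Import Defs.
Local Open Scope R_scope.

(** Summing the [w]-equations over a neighbourhood shows that [sum_j w_ijk] is conserved, so the
    mean of the [g_ijk] over [j] is [1/n_ik] times the pseudo-gradient component [P_ik(x)], while
    their deviations [E_ijk] from that mean contract at a rate independent of [delta] (Poincare
    inequality on the connected graph) up to a forcing of size [O(delta)].  With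
    [V = sum n_ik (x_ik - xs_ik)^2 / (2 dbar_ik)], [rho = (x - xs) . P(x)] and [W = sum E_ijk^2 =
    |Gbar|^2], the energy [U = V + W] satisfies [U' <= - delta (rho + lam W) + delta^2 C] on
    sublevel sets, [C] depending on the sublevel only.  Since [rho] is nondecreasing along rays
    issued from [xs], [rho + lam W] is bounded below by a positive constant on each [U >= u].  For
    small [delta], as long as [U t] stays above a threshold, this gives
    [U t + delta t c <= U 0] for every [c] that bounds [(rho + lam W) / 2] from below on
    [U >= U t]; the largest [u] compatible with these inequalities is the class-KL bound. *)

(* [Reals] also exports a record field named [ind]. *)
Local Notation ind := Defs.ind.
(* The Stdlib takes over the delimiter [%R] of [ring_scope]. *)
Delimit Scope ring_scope with Ri.

(** A2 is strict monotonicity only: it gives neither a rate near [xs] nor growth of [rho] at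
    infinity, and the sets [U >= u] are unbounded. Moving along rays reduces the lower bound on
    [rho] to a compact level set of [V]. The resulting rates have no explicit form, so they are kept
    as a relation between heights and rates, with no regularity asked of it, and the KL function is
    read off from that relation instead of from the solution of a differential inequality. The
    relation mentions none of [delta], [Delta], [v], which is why a single [phi] serves them all.
    The two parts of [U] are coupled: the deviations enter [V'] and the motion of [x] enters [W'],
    each time with a factor [delta] and linearly in the deviations. Young's inequality absorbs both
    into half of the consensus decay at a cost of order [delta ^ 2], which a useful decay of order
    [delta] dominates once [delta] is small. What remains of the consensus decay is slowed down by
    the factor [delta <= 1], so that both parts live on the time scale [delta * t]. *)

(** * Finite sums and indicators *)

Lemma rsum_ext {n : nat} (F G : 'I_n -> R) : (forall i, F i = G i) -> rsum F = rsum G.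
Proof. by move=> FG; apply: eq_bigr => i _; exact: FG. Qed.

Lemma rsum_add {n : nat} (F G : 'I_n -> R) : rsum (fun i => F i + G i) = rsum F + rsum G.
Proof. exact: big_split. Qed.

Lemma rsum_mull {n : nat} (c : R) (F : 'I_n -> R) : rsum (fun i => c * F i) = c * rsum F.
Proof. by symmetry; exact: big_distrr. Qed.

Lemma rsum_opp {n : nat} (F : 'I_n -> R) : rsum (fun i => - F i) = - rsum F.
Proof.
rewrite (_ : - rsum F = -1 * rsum F); last by ring.
by rewrite -rsum_mull; apply: rsum_ext => i; ring.
Qed.

Lemma rsum_sub {n : nat} (F G : 'I_n -> R) : rsum (fun i => F i - G i) = rsum F - rsum G.
Proof. by rewrite /Rminus rsum_add rsum_opp. Qed.

Lemma rsum_exchange {n p : nat} (F : 'I_n -> 'I_p -> R) :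
  rsum (fun i => rsum (fun j => F i j)) = rsum (fun j => rsum (fun i => F i j)).
Proof. exact: exchange_big. Qed.

Lemma rsum_le {n : nat} (F G : 'I_n -> R) : (forall i, F i <= G i) -> rsum F <= rsum G.
Proof.
move=> FG; rewrite /rsum; elim/big_ind2: _ => [|x1 x2 y1 y2 ? ?|i _] //; lra.
Qed.

Lemma rsum_ge0 {n : nat} (F : 'I_n -> R) : (forall i, 0 <= F i) -> 0 <= rsum F.
Proof. by move=> F0; rewrite /rsum; elim/big_ind: _ => [|x y ? ?|i _] //; lra. Qed.

Lemma rsum_ge_term {n : nat} (F : 'I_n -> R) (k : 'I_n) :
  (forall i, 0 <= F i) -> F k <= rsum F.
Proof.
move=> F0; rewrite /rsum (bigD1 k) //=.
have le_add b : 0 <= b -> F k <= F k + b by lra.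
apply: le_add; by elim/big_ind: _ => [|x y ? ?|i _] //; lra.
Qed.

Lemma rsum_delta {n : nat} (k : 'I_n) (F : 'I_n -> R) :
  rsum (fun i => (if i == k then 1 else 0) * F i) = F k.
Proof.
rewrite /rsum (bigD1 k) //= eqxx big1 => [|i /negbTE ->]; first by ring.
by ring.
Qed.

Lemma rsum_const {n : nat} (c : R) : rsum (fun _ : 'I_n => c) = INR n * c.
Proof.
rewrite /rsum; elim: n => [|n IH]; first by rewrite big_ord0 /=; ring.
by rewrite big_ord_recr IH S_INR /=; ring.
Qed.

Lemma ind_sqr (P : Prop) : ind P * ind P = ind P.
Proof. by rewrite /Defs.ind; case: excluded_middle_informative => ? /=; ring. Qed.

Lemma ind_ge0 (P : Prop) : 0 <= ind P.
Proof. by rewrite /Defs.ind; case: excluded_middle_informative => ? /=; lra. Qed.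

Lemma ind_true (P : Prop) : P -> ind P = 1.
Proof. by rewrite /Defs.ind; case: excluded_middle_informative. Qed.

Lemma ind_false (P : Prop) : ~ P -> ind P = 0.
Proof. by rewrite /Defs.ind; case: excluded_middle_informative. Qed.

(** * Projection onto the complement of the all-ones vector *)

(** Enumerating [A] makes [Q] a square matrix, and a left inverse of a square matrix is also a right
    inverse. *)
Lemma orthonormal_rows {p : nat} (A : pred 'I_p) (Q : 'I_p -> 'I_#|A| -> R) :
  (forall c c', \big[Rplus/0]_(j in A) (Q j c * Q j c') = if c == c' then 1 else 0) ->
  forall j j', j \in A -> j' \in A ->
    rsum (fun c => Q j c * Q j' c) = if j == j' then 1 else 0.
Proof.
move=> hQ j j' jA j'A.
pose M : 'M[R]_#|A| := (\matrix_(i, c) Q (enum_val i) c)%Ri.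
have MtM : (M^T *m M = 1%:M)%Ri.
  apply/matrixP => c c'; rewrite !mxE.
  under eq_bigr do rewrite !mxE.
  have := hQ c c'; rewrite (big_enum_val (fun j => Q j c * Q j c')) /= => E.
  by apply: etrans E _; case: eqP.
have /matrixP/(_ (enum_rank_in jA j) (enum_rank_in jA j')) := mulmx1C MtM.
rewrite !mxE; under eq_bigr do rewrite !mxE !enum_rankK_in //.
move=> E; apply: etrans E _.
rewrite (_ : (_ == _) = (j == j')); first by case: eqP.
apply/eqP/eqP => [H|<-] //.
by rewrite -(enum_rankK_in jA jA) H enum_rankK_in.
Qed.

Section Projection.
Context {p : nat} (S : 'I_p -> Prop) (Q : 'I_p -> nat -> R).
Let s j := ind (S j).
Let n := rsum s.

Lemma card_ind :
  INR (\sum_(j < p) (if excluded_middle_informative (S j) then 1 else 0))%nat = n.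
Proof.
rewrite /n /rsum /s.
elim/big_ind2: _ => [|x1 x2 y1 y2 <- <-|i _] //; first by rewrite plus_INR.
by rewrite /Defs.ind; case: excluded_middle_informative.
Qed.

(** This is the entrywise form of [R R^T = I - 1 1^T / n], obtained from the orthonormality of the
    rows of the completed matrix. *)
Lemma orthonormal_complement (q : nat) :
  q = (\sum_(j < p) (if excluded_middle_informative (S j) then 1 else 0))%nat ->
  (0 < q)%nat ->
  (forall c c', (c < q - 1)%nat -> (c' < q - 1)%nat ->
    rsum (fun j => s j * Q j c * Q j c') = if c == c' then 1 else 0) ->
  (forall c, (c < q - 1)%nat -> rsum (fun j => s j * Q j c) = 0) ->
  forall j j', S j -> S j' ->
    1 / n + \big[Rplus/0]_(c < q - 1) (Q j c * Q j' c) = if j == j' then 1 else 0.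
Proof.
case: q => // q qE _; rewrite subn1 /= => orth orth1 j j' Sj Sj'.
have nE : INR q.+1 = n by rewrite qE card_ind.
have n0 : 0 < n by rewrite -nE; apply: lt_0_INR; apply/ltP.
pose A : pred 'I_p := fun j => if excluded_middle_informative (S j) then true else false.
have inA k : S k -> k \in A by rewrite /in_mem /= /A; case: excluded_middle_informative.
have cardA : #|A| = q.+1.
  rewrite qE -sum1_card big_mkcond /=; apply: eq_bigr => k _.
  by rewrite /in_mem /= /A; case: excluded_middle_informative.
have sumA (F : 'I_p -> R) : \big[Rplus/0]_(k in A) F k = rsum (fun k => s k * F k).
  rewrite big_mkcond /=; apply: eq_bigr => k _.
  by rewrite /in_mem /= /A /s /Defs.ind; case: excluded_middle_informative => ? /=; ring.
(* the column of index [q] is the normalized all-ones vector *)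
pose Q' (k : 'I_p) (c : nat) : R := if (c < q)%nat then Q k c else / sqrt n.
have sq : / sqrt n * / sqrt n = / n.
  by rewrite -Rinv_mult sqrt_sqrt //; lra.
have := orthonormal_rows A (fun k c => Q' k c) _ j j' (inA _ Sj) (inA _ Sj').
move=> H; rewrite -H.
- rewrite /rsum; clear H; rewrite cardA big_ord_recr /= {3 4}/Q' ltnn sq /Rdiv Rmult_1_l Rplus_comm; congr (_ + _).
  by apply: eq_bigr => c _; rewrite /Q' ltn_ord.
- move=> c c'; rewrite sumA.
  have last (d : 'I_#|A|) : (d < q)%nat = false -> d = q :> nat.
    have lt_d : (d < q.+1)%nat by rewrite -cardA ltn_ord.
    by move=> dq; apply/eqP; rewrite eqn_leq -ltnS lt_d leqNgt dq.
  case cq: (c < q)%nat; case c'q: (c' < q)%nat; rewrite /Q' ?cq ?c'q.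
  + rewrite -[RHS]orth //.
    apply: rsum_ext => k. rewrite /=; ring.
  + have -> : (c == c') = false by apply/eqP => E; rewrite E c'q in cq.
    rewrite -[RHS](Rmult_0_r (/ sqrt n)) -(orth1 c) // -rsum_mull.
    by apply: rsum_ext => k; ring.
  + have -> : (c == c') = false by apply/eqP => E; rewrite -E cq in c'q.
    rewrite -[RHS](Rmult_0_r (/ sqrt n)) -(orth1 c') // -rsum_mull.
    by apply: rsum_ext => k; ring.
  + have -> : c == c' by apply/eqP/val_inj; rewrite /= (last _ cq) (last _ c'q).
    rewrite sq -(Rinv_l n); last lra.
    rewrite -rsum_mull; apply: rsum_ext => k; ring.
Qed.

(** Expanding the squares leaves the quadratic form of [R R^T], so the result is the same for every
    admissible choice of [R]. *)
Lemma projection_sqnorm (q : nat) (g : 'I_p -> R) :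
  q = (\sum_(j < p) (if excluded_middle_informative (S j) then 1 else 0))%nat ->
  (0 < q)%nat ->
  (forall c c', (c < q - 1)%nat -> (c' < q - 1)%nat ->
    rsum (fun j => s j * Q j c * Q j c') = if c == c' then 1 else 0) ->
  (forall c, (c < q - 1)%nat -> rsum (fun j => s j * Q j c) = 0) ->
  \big[Rplus/0]_(c < q - 1) (rsum (fun j => s j * Q j c * g j)) ^ 2 =
  rsum (fun j => s j * (g j) ^ 2) - (rsum (fun j => s j * g j)) ^ 2 / n.
Proof.
move=> qE q0 orth orth1.
have compl := orthonormal_complement q qE q0 orth orth1.
transitivity (\big[Rplus/0]_(c < q - 1) rsum (fun j => rsum (fun j' =>
    (s j * g j * (s j' * g j')) * (Q j c * Q j' c)))).
  apply: eq_bigr => c _; rewrite /= Rmult_1_r -rsum_mull.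
  apply: rsum_ext => j; rewrite Rmult_comm -rsum_mull.
  by apply: rsum_ext => j'; ring.
transitivity (rsum (fun j => rsum (fun j' => (s j * g j * (s j' * g j')) *
    \big[Rplus/0]_(c < q - 1) (Q j c * Q j' c)))).
  rewrite {1}/rsum exchange_big; apply: eq_bigr => j _ /=.
  rewrite {1}/rsum exchange_big; apply: eq_bigr => j' _ /=.
  by rewrite big_distrr.
transitivity (rsum (fun j => rsum (fun j' => (if j' == j then 1 else 0) * (s j * g j * (s j' * g j'))
    - (/ n * (s j * g j)) * (s j' * g j')))).
  apply: rsum_ext => j; apply: rsum_ext => j'.
  case: (excluded_middle_informative (S j)) => Sj; last by rewrite /s (ind_false _ Sj); ring.
  case: (excluded_middle_informative (S j')) => Sj'; last by rewrite /s (ind_false _ Sj'); ring.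
  have := compl j j' Sj Sj'; rewrite eq_sym => <-.
  by rewrite /Rdiv; ring.
transitivity (rsum (fun j => s j * g j ^ 2 - (rsum (fun j => s j * g j) / n) * (s j * g j))).
  apply: rsum_ext => j; rewrite rsum_sub rsum_delta rsum_mull /Rdiv.
  have := ind_sqr (S j); rewrite -/(s j) => E.
  have E0 : (s j * s j - s j) * g j ^ 2 = 0 by rewrite E; ring.
  by rewrite /Rdiv; lra.
by rewrite rsum_sub rsum_mull; congr (_ - _); rewrite /Rdiv; ring.
Qed.
End Projection.

(** Merges constants found agent by agent into one constant for all agents, by taking maxima along
    an enumeration. *)
Lemma finite_bound {I : finType} (P : I -> R -> Prop) :
  (forall i K K', K <= K' -> P i K -> P i K') ->
  (forall i, exists K, P i K) -> exists K, 0 < K /\ forall i, P i K.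
Proof.
move=> mono ex.
suff [K [K0 HK]] : exists K, 0 < K /\ forall i, i \in enum I -> P i K.
  by exists K; split=> // i; apply: HK; rewrite mem_enum.
elim: (enum I) => [|i s [K [K0 HK]]]; first by exists 1; split=> //; lra.
have [K' HK'] := ex i.
exists (Rmax K K'); split; first by have := Rmax_l K K'; lra.
move=> k; rewrite in_cons => /orP[/eqP ->|ks].
- by apply: mono HK'; exact: Rmax_r.
- by apply: mono (HK _ ks); exact: Rmax_l.
Qed.

(** * Poincare inequality and consensus on a weighted graph *)

Section WeightedGraph.
Context {p : nat} (S : 'I_p -> Prop) (a : 'I_p -> 'I_p -> R).
Hypothesis a_sym : forall j l, a j l = a l j.
Hypothesis a_ge0 : forall j l, 0 <= a j l.
Hypothesis connected : forall u v, S u -> S v ->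
  clos_refl_trans _ (fun q r => S q /\ S r /\ 0 < a q r) u v.
Let s j := ind (S j).
Let n := rsum s.
Hypothesis n_gt0 : 0 < n.

(** The sum runs over ordered pairs: for symmetric weights this is twice the quadratic form of the
    Laplacian of the graph induced on [S]. *)
Definition dirichlet (g : 'I_p -> R) : R :=
  rsum (fun j => rsum (fun l => s j * s l * a j l * (g j - g l) ^ 2)).

Definition variation (g : 'I_p -> R) : R :=
  rsum (fun j => s j * (g j - rsum (fun l => s l * g l) / n) ^ 2).

Lemma dirichlet_ge0 g : 0 <= dirichlet g.
Proof.
apply: rsum_ge0 => j; apply: rsum_ge0 => l.
have := ind_ge0 (S j); have := ind_ge0 (S l) => sl sj.
apply: Rmult_le_pos; last exact: pow2_ge_0.
by apply: Rmult_le_pos => //; exact: Rmult_le_pos.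
Qed.

(** An edge is controlled by its own term of [dirichlet]; two paths are concatenated by
    [(p + q) ^ 2 <= 2 p ^ 2 + 2 q ^ 2]. *)
Lemma path_difference_bound u v :
  clos_refl_trans _ (fun q r => S q /\ S r /\ 0 < a q r) u v ->
  exists C, 0 <= C /\ forall g, (g u - g v) ^ 2 <= C * dirichlet g.
Proof.
elim=> {u v} [u v [Su [Sv auv]]|u|u v w _ [C [C0 HC]] _ [C' [C'0 HC']]].
- exists (/ a u v); split; first by apply/Rlt_le/Rinv_0_lt_compat.
  move=> g.
  have ge0 j l : 0 <= s j * s l * a j l * (g j - g l) ^ 2.
    apply: Rmult_le_pos; last exact: pow2_ge_0.
    apply: Rmult_le_pos => //; apply: Rmult_le_pos; exact: ind_ge0.
  have H1 := rsum_ge_term (fun l => s u * s l * a u l * (g u - g l) ^ 2) v (ge0 u).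
  have H2 := rsum_ge_term (fun j => rsum (fun l => s j * s l * a j l * (g j - g l) ^ 2)) u
    (fun j => rsum_ge0 _ (ge0 j)).
  have H3 : a u v * (g u - g v) ^ 2 <= dirichlet g.
    have su : s u = 1 := ind_true _ Su; have sv : s v = 1 := ind_true _ Sv.
    have : s u * s v * a u v * (g u - g v) ^ 2 <= dirichlet g := Rle_trans _ _ _ H1 H2.
    by rewrite su sv; lra.
  have -> : (g u - g v) ^ 2 = / a u v * (a u v * (g u - g v) ^ 2) by field; lra.
  by apply: Rmult_le_compat_l => //; apply/Rlt_le/Rinv_0_lt_compat.
- by exists 0; split; [lra|move=> g; have := dirichlet_ge0 g; nra].
- exists (2 * C + 2 * C'); split; first by lra.
  move=> g; have := HC g; have := HC' g; have := pow2_ge_0 (g u - g v - (g v - g w)).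
  by nra.
Qed.

Lemma sum_weighted_sqr_diff (g : 'I_p -> R) (m : R) :
  rsum (fun j => s j * (g j - m) ^ 2) =
  rsum (fun j => s j * g j ^ 2) - 2 * m * rsum (fun j => s j * g j) + n * m ^ 2.
Proof.
rewrite /n (Rmult_comm (rsum s)) -!rsum_mull -rsum_sub -rsum_add.
by apply: rsum_ext => j; ring.
Qed.

Lemma variationE g : variation g =
  rsum (fun j => s j * g j ^ 2) - (rsum (fun j => s j * g j)) ^ 2 / n.
Proof.
by rewrite /variation sum_weighted_sqr_diff; field; lra.
Qed.

Lemma variation_ge0 g : 0 <= variation g.
Proof.
apply: rsum_ge0 => j; apply: Rmult_le_pos; [exact: ind_ge0|exact: pow2_ge_0].
Qed.

Lemma variation_ge_term g k : S k ->
  (g k - rsum (fun l => s l * g l) / n) ^ 2 <= variation g.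
Proof.
move=> Sk; rewrite -[X in X <= _]Rmult_1_l -(ind_true _ Sk).
apply: (rsum_ge_term (fun j => s j * (g j - rsum (fun l => s l * g l) / n) ^ 2) k) => j.
by apply: Rmult_le_pos; [exact: ind_ge0|exact: pow2_ge_0].
Qed.

Lemma variation_pairs g :
  rsum (fun j => rsum (fun l => s j * s l * (g j - g l) ^ 2)) = 2 * n * variation g.
Proof.
rewrite variationE.
transitivity (rsum (fun l => s l * rsum (fun j => s j * (g j - g l) ^ 2))).
  rewrite rsum_exchange; apply: rsum_ext => l; rewrite -rsum_mull.
  by apply: rsum_ext => j; ring.
transitivity (rsum (fun l => rsum (fun j => s j * g j ^ 2) * s l
   + n * (s l * g l ^ 2) - 2 * rsum (fun j => s j * g j) * (s l * g l))).
  by apply: rsum_ext => l; rewrite sum_weighted_sqr_diff; ring.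
rewrite rsum_sub rsum_add !rsum_mull -/n; field; lra.
Qed.

(** Connectedness bounds the difference over every pair of vertices of [S], and [variation_pairs]
    recovers the variation from these differences; no eigenvalue of the Laplacian is used. *)
Lemma poincare : exists kappa, 0 < kappa /\ forall g, variation g <= kappa * dirichlet g.
Proof.
pose P (uv : 'I_p * 'I_p) K := forall g,
  s uv.1 * s uv.2 * (g uv.1 - g uv.2) ^ 2 <= K * dirichlet g.
have [| [u v] |K [K0 HK]] := @finite_bound _ P.
- move=> uv K K' KK' H g; apply: Rle_trans (H g) _.
  by apply: Rmult_le_compat_r => //; exact: dirichlet_ge0.
- case: (excluded_middle_informative (S u /\ S v)) => [[Su Sv]|nS].
    have [C [_ HC]] := path_difference_bound u v (connected u v Su Sv).
    by exists C => g; rewrite /= /s !ind_true // !Rmult_1_l; exact: HC.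
  exists 0 => g; rewrite /= Rmult_0_l.
  case: (excluded_middle_informative (S u)) => Su; last by rewrite /s (ind_false _ Su); lra.
  case: (excluded_middle_informative (S v)) => Sv; last by rewrite /s (ind_false _ Sv); lra.
  by case: nS.
(* Each of the [p * p] ordered pairs costs at most [K * dirichlet g]; the added 1 gives positivity
   at once. *)
exists (INR p * (INR p * K) / (2 * n) + 1).
have ge0 : 0 <= INR p * (INR p * K) / (2 * n).
  apply: Rmult_le_pos; last by apply/Rlt_le/Rinv_0_lt_compat; lra.
  by apply: Rmult_le_pos; [exact: pos_INR|apply: Rmult_le_pos; [exact: pos_INR|lra]].
split; first by lra.
move=> g; have D0 := dirichlet_ge0 g.
have : 2 * n * variation g <= INR p * (INR p * (K * dirichlet g)).
  rewrite -variation_pairs -rsum_const; apply: rsum_le => j; rewrite -rsum_const.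
  by apply: rsum_le => l; exact: (HK (j, l)).
move=> H; apply: (Rmult_le_reg_l (2 * n)); first by lra.
apply: Rle_trans H _.
have -> : 2 * n * ((INR p * (INR p * K) / (2 * n) + 1) * dirichlet g) =
  INR p * (INR p * (K * dirichlet g)) + 2 * n * dirichlet g by field; lra.
have : 0 <= 2 * n * dirichlet g by apply: Rmult_le_pos => //; lra.
lra.
Qed.

(** Exchanging [j] and [l] in one of two copies of the double sum turns the factor [g j - m] into
    [g j - g l], so the reference value [m] drops out. *)
Lemma laplacian_form (g : 'I_p -> R) (m : R) :
  2 * rsum (fun j => s j * (g j - m) * - rsum (fun l => s l * a j l * (g j - g l))) =
  - dirichlet g.
Proof.
pose F j l := s j * s l * a j l * (g j - m) * (g j - g l).
have -> : rsum (fun j => s j * (g j - m) * - rsum (fun l => s l * a j l * (g j - g l))) =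
    - rsum (fun j => rsum (fun l => F j l)).
  rewrite -rsum_opp; apply: rsum_ext => j; rewrite -rsum_opp -rsum_mull -rsum_opp.
  by apply: rsum_ext => l; rewrite /F; ring.
have -> : 2 * - rsum (fun j => rsum (fun l => F j l)) =
    - (rsum (fun j => rsum (fun l => F j l)) + rsum (fun j => rsum (fun l => F l j))).
  by rewrite [X in _ + X]rsum_exchange; ring.
congr (- _); rewrite -rsum_add; apply: rsum_ext => j; rewrite -rsum_add; apply: rsum_ext => l.
by rewrite /F (a_sym l j); ring.
Qed.

Lemma laplacian_sum0 (g : 'I_p -> R) :
  rsum (fun j => s j * - rsum (fun l => s l * a j l * (g j - g l))) = 0.
Proof.
pose F j l := s j * s l * a j l * (g j - g l).
have E : rsum (fun j => s j * - rsum (fun l => s l * a j l * (g j - g l))) =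
    - rsum (fun j => rsum (fun l => F j l)).
  rewrite -rsum_opp; apply: rsum_ext => j; rewrite -rsum_opp -rsum_mull -rsum_opp.
  by apply: rsum_ext => l; rewrite /F; ring.
have E' : rsum (fun j => rsum (fun l => F j l)) = - rsum (fun j => rsum (fun l => F j l)).
  rewrite {1}rsum_exchange -rsum_opp; apply: rsum_ext => j; rewrite -rsum_opp.
  by apply: rsum_ext => l; rewrite /F (a_sym l j); ring.
by rewrite E; lra.
Qed.

(** With [m] the mean of [g], the left side is the derivative of the variation along
    [g' = - L g + h]; here [h] will be the time derivative of the cost gradients. *)
Lemma perturbed_consensus_rate (kappa H m : R) (g h : 'I_p -> R) :
  0 < kappa -> variation g <= kappa * dirichlet g -> (forall j, Rabs (h j) <= H) ->
  2 * rsum (fun j => s j * (g j - m) * (- rsum (fun l => s l * a j l * (g j - g l)) + h j)) <=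
  - variation g / kappa + 2 * H * rsum (fun j => s j * Rabs (g j - m)).
Proof.
move=> k0 gap hH.
have -> : rsum (fun j => s j * (g j - m) * (- rsum (fun l => s l * a j l * (g j - g l)) + h j)) =
    rsum (fun j => s j * (g j - m) * - rsum (fun l => s l * a j l * (g j - g l))) +
    rsum (fun j => s j * (g j - m) * h j).
  by rewrite -rsum_add; apply: rsum_ext => j; ring.
rewrite Rmult_plus_distr_l laplacian_form.
have Hv : - dirichlet g <= - variation g / kappa.
  have : variation g / kappa <= dirichlet g.
    apply: (Rmult_le_reg_l kappa) => //; rewrite (_ : kappa * _ = variation g) //; field; lra.
  rewrite /Rdiv; lra.
have : rsum (fun j => s j * (g j - m) * h j) <= H * rsum (fun j => s j * Rabs (g j - m)).
  rewrite -rsum_mull; apply: rsum_le => j.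
  have := Rle_abs ((g j - m) * h j); rewrite Rabs_mult => le1.
  have le2 : Rabs (g j - m) * Rabs (h j) <= Rabs (g j - m) * H.
    by apply: Rmult_le_compat_l; [exact: Rabs_pos|exact: hH].
  have := ind_ge0 (S j); rewrite -/(s j) => sj.
  rewrite Rmult_assoc (_ : H * (s j * _) = s j * (Rabs (g j - m) * H)); last by ring.
  by apply: Rmult_le_compat_l => //; lra.
lra.
Qed.
End WeightedGraph.

(** * Limits, continuity and compactness on the action space *)

Section RealFilterLimits.
Context {T : Type} (Phi : (T -> Prop) -> Prop) {FPhi : Filter Phi}.

Lemma filterlim_Rplus (f g : T -> R) (a b : R) :
  filterlim f Phi (locally a) -> filterlim g Phi (locally b) ->
  filterlim (fun t => f t + g t) Phi (locally (a + b)).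
Proof. by move=> fa gb; apply: filterlim_comp_2 fa gb _; exact: (@filterlim_plus _ R_NormedModule). Qed.

Lemma filterlim_Rmult (f g : T -> R) (a b : R) :
  filterlim f Phi (locally a) -> filterlim g Phi (locally b) ->
  filterlim (fun t => f t * g t) Phi (locally (a * b)).
Proof. by move=> fa gb; apply: filterlim_comp_2 fa gb _; exact: (@filterlim_mult R_AbsRing). Qed.

Lemma filterlim_Rminus (f g : T -> R) (a b : R) :
  filterlim f Phi (locally a) -> filterlim g Phi (locally b) ->
  filterlim (fun t => f t - g t) Phi (locally (a - b)).
Proof.
move=> fa gb; rewrite /Rminus; apply: filterlim_Rplus => //.
by apply: filterlim_comp gb _; exact: (@filterlim_opp _ R_NormedModule).
Qed.

Lemma filterlim_rsum {n : nat} (F : 'I_n -> T -> R) (l : 'I_n -> R) :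
  (forall i, filterlim (F i) Phi (locally (l i))) ->
  filterlim (fun t => rsum (fun i => F i t)) Phi (locally (rsum l)).
Proof.
elim: n F l => [|n IH] F l Fl; rewrite /rsum.
  rewrite big_ord0; apply: (filterlim_ext (fun _ => 0)); last exact: filterlim_const.
  by move=> t; rewrite big_ord0.
rewrite big_ord_recl; apply: (filterlim_ext (fun t => F ord0 t + rsum (fun i => F (lift ord0 i) t))).
  by move=> t; rewrite /rsum big_ord_recl.
by apply: filterlim_Rplus (Fl _) _; apply: IH.
Qed.
End RealFilterLimits.

Lemma filter_all {T : Type} (Phi : (T -> Prop) -> Prop) {FPhi : Filter Phi}
    {I : finType} (P : I -> T -> Prop) :
  (forall i, Phi (P i)) -> Phi (fun t => forall i, P i t).
Proof.
move=> PhiP.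
suff H : Phi (fun t => forall i, i \in enum I -> P i t).
  by apply: filter_imp H => t H i; apply: H; rewrite mem_enum.
elim: (enum I) => [|i s IH]; first exact: filter_forall.
apply: filter_imp (filter_and _ _ (PhiP i) IH) => t [H1 H2] k.
by rewrite in_cons => /orP[/eqP ->//|]; exact: H2.
Qed.

Section Coordinates.
Context {N : nat} {m : 'I_N -> nat}.
Implicit Types (x y : vec m).

(** Flattens the dependent double index into one finite type, over which one can sum, enumerate and
    take maxima. *)
Definition coord : finType := {i : 'I_N & 'I_(m i)}.
Definition mkcoord {i : 'I_N} (j : 'I_(m i)) : coord := existT _ i j.
Definition at_coord x (c : coord) : R := x (tag c) (tagged c).

(** Neighbourhood filter of the sup norm; with finitely many coordinates it gives the same topology
    as [vnorm]. *)
Definition nb x : (vec m -> Prop) -> Prop := fun Q =>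
  exists eta, 0 < eta /\ forall y, (forall i j, Rabs (y i j - x i j) < eta) -> Q y.

#[export] Instance nb_filter x : Filter (nb x).
Proof.
split.
- by exists 1; split=> //; lra.
- move=> P Q [e [e0 He]] [e' [e'0 He']]; exists (Rmin e e'); split; first exact: Rmin_pos.
  move=> y Hy; split; [apply: He|apply: He'] => i j; apply: Rlt_le_trans (Hy i j) _.
  + exact: Rmin_l.
  + exact: Rmin_r.
- by move=> P Q PQ [e [e0 He]]; exists e; split=> // y Hy; apply/PQ/He.
Qed.

Lemma filterlim_coord x i j : filterlim (fun y => y i j) (nb x) (locally (x i j)).
Proof. by move=> P [e He]; exists e; split=> [|y Hy]; [exact: cond_pos|exact: He]. Qed.

Lemma filterlim_vec {T : Type} (Phi : (T -> Prop) -> Prop) {FPhi : Filter Phi}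
    (X : T -> vec m) x :
  (forall i j, filterlim (fun t => X t i j) Phi (locally (x i j))) -> filterlim X Phi (nb x).
Proof.
move=> Xx Q [e [e0 He]]; rewrite /filtermap.
have H : Phi (fun t => forall c : coord, Rabs (at_coord (X t) c - at_coord x c) < e).
  apply: filter_all => -[i j].
  apply: (Xx i j (fun r => Rabs (r - x i j) < e)).
  by exists (mkposreal e e0) => z Hz; exact: Hz.
by apply: filter_imp H => t Ht; apply: He => i j; exact: (Ht (mkcoord j)).
Qed.

Lemma sqnorm_term x i j : x i j ^ 2 <= sqnorm x.
Proof.
apply: Rle_trans (rsum_ge_term (fun i => rsum (fun j => x i j ^ 2)) i _).
- by apply: (rsum_ge_term (fun j => x i j ^ 2)) => k; exact: pow2_ge_0.
- by move=> k; apply: rsum_ge0 => l; exact: pow2_ge_0.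
Qed.

Lemma sqnorm_ge0 x : 0 <= sqnorm x.
Proof. by apply: rsum_ge0 => i; apply: rsum_ge0 => j; exact: pow2_ge_0. Qed.

Lemma vnorm_small (eps : R) : 0 < eps -> exists eta, 0 < eta /\
  forall x, (forall i j, Rabs (x i j) < eta) -> vnorm x < eps.
Proof.
move=> e0.
pose M := rsum (fun i => rsum (fun _ : 'I_(m i) => 1)).
have M0 : 0 <= M by apply: rsum_ge0 => i; apply: rsum_ge0 => j; lra.
have eta0 : 0 < eps / (M + 1) by apply: Rdiv_lt_0_compat; lra.
exists (eps / (M + 1)); split => // x Hx.
set eta := eps / (M + 1) in eta0 Hx.
have eE : eps = eta * (M + 1) by rewrite /eta; field; lra.
rewrite /vnorm -(sqrt_pow2 eps); last by lra.
apply: sqrt_lt_1; [exact: sqnorm_ge0|exact: pow2_ge_0|].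
have : sqnorm x <= eta ^ 2 * M.
  rewrite /M -rsum_mull; apply: rsum_le => i; rewrite -rsum_mull; apply: rsum_le => j.
  rewrite Rmult_1_r -(pow2_abs (x i j)); apply: pow_incr; split; first exact: Rabs_pos.
  by apply/Rlt_le/Hx.
have : 0 < eta ^ 2 by apply: pow_lt.
by rewrite eE; nra.
Qed.

Lemma contv_filterlim (F : vec m -> R) x : contv F -> filterlim F (nb x) (locally (F x)).
Proof.
move=> FC P [e He]; have [d [d0 Hd]] := FC x e (cond_pos e).
have [eta [eta0 Heta]] := vnorm_small _ d0.
by exists eta; split=> // y Hy; apply: He; apply: Hd; apply: Heta.
Qed.

(** One coordinate is treated at a time, by extraction from the previous extraction. The condition
    [n <= sigma n] replaces strict monotonicity: it is stable under composition and preserves limits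
    already obtained. *)
Lemma bolzano_weierstrass_coords (X : nat -> coord -> R) (B : R) (s : seq coord) :
  (forall n c, Rabs (X n c) <= B) ->
  exists sigma : nat -> nat, (forall n, (n <= sigma n)%coq_nat) /\
    forall c, c \in s -> exists l, Un_cv (fun n => X (sigma n) c) l.
Proof.
move=> XB; elim: s => [|c s [sigma [sig_ge sig_cv]]].
  by exists (fun n => n); split=> // n; exact: Nat.le_refl.
have inB n : -B <= X (sigma n) c <= B by apply/Rabs_le_between.
have [l Hl] := Bolzano_Weierstrass _ (fun r => -B <= r <= B) (compact_P3 (-B) B) inB.
have pos n : 0 < / (INR n + 1) by apply: Rinv_0_lt_compat; have := pos_INR n; lra.
have ex n : exists p, (n <= p)%coq_nat /\ Rabs (X (sigma p) c - l) < / (INR n + 1).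
  have [|p [np Hp]] := Hl (fun r => Rabs (r - l) < / (INR n + 1)) n; last by exists p.
  by exists (mkposreal _ (pos n)) => r Hr; exact: Hr.
have [tau Htau] := functional_choice _ ex.
exists (fun n => sigma (tau n)); split.
  move=> n; apply: Nat.le_trans (sig_ge _); exact: (proj1 (Htau n)).
move=> c'; rewrite in_cons => /orP[/eqP ->|/sig_cv [l' Hl']].
- exists l => eps eps0; have [n0 [Hn0 n0pos]] := archimed_cor1 eps eps0.
  exists n0 => n Hn; apply: Rlt_trans (proj2 (Htau n)) _.
  apply: Rlt_trans Hn0; apply: Rinv_lt_contravar.
    apply: Rmult_lt_0_compat; first exact: lt_0_INR.
    by have := pos_INR n; lra.
  by have := le_INR _ _ Hn; lra.
- exists l' => eps eps0; have [n0 Hn0] := Hl' eps eps0.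
  exists n0 => n Hn; apply: Hn0; apply: Nat.le_trans (proj1 (Htau n)); exact: Hn.
Qed.

(* Compactness of boxes: a property that holds locally with some constant holds on a box
   with one constant. *)
Lemma box_uniform (x0 : vec m) (B : R) (Q : R -> vec m -> Prop) :
  (forall K K' x, K <= K' -> Q K x -> Q K' x) ->
  (forall x, exists K, nb x (Q K)) ->
  exists K, forall x, (forall i j, Rabs (x i j - x0 i j) <= B) -> Q K x.
Proof.
move=> mono loc.
case: (classic (exists K, forall x, (forall i j, Rabs (x i j - x0 i j) <= B) -> Q K x)) => // nex.
(* A sequence that violates the property with constant [n] at step [n] accumulates at some point,
   whose local constant it ends up contradicting. *)
have ex (n : nat) : exists x, (forall i j, Rabs (x i j - x0 i j) <= B) /\ ~ Q (INR n) x.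
  apply: NNPP => H; apply: nex; exists (INR n) => x Hx.
  by apply: NNPP => nQ; apply: H; exists x.
have [X HX] := functional_choice _ ex.
have [sigma [sig_ge sig_cv]] := @bolzano_weierstrass_coords
  (fun n c => at_coord (X n) c - at_coord x0 c) B (enum coord) (fun n c => proj1 (HX n) _ _).
have ex_lim c : exists l, Un_cv (fun n => at_coord (X (sigma n)) c - at_coord x0 c) l.
  by apply: sig_cv; rewrite mem_enum.
have [l Hl] := functional_choice _ ex_lim.
pose x : vec m := fun i j => l (mkcoord j) + x0 i j.
have [K [eta [eta0 HK]]] := loc x.
have ev : eventually (fun n => forall c, Rabs (at_coord (X (sigma n)) c - at_coord x c) < eta).
  apply: filter_all => c; have [n0 Hn0] := Hl c eta eta0.
  exists n0 => n /Hn0; rewrite /Rdist => H.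
  have -> : at_coord x c = l c + at_coord x0 c by case: c {H Hn0}.
  by rewrite (_ : _ - _ = at_coord (X (sigma n)) c - at_coord x0 c - l c) //; ring.
have [n0 Hn0] := ev.
have [k Hk] : exists k : nat, K <= INR k.
  by have [k Hk] := INR_unbounded K; exists k; lra.
pose n := Nat.max n0 k.
case: (proj2 (HX (sigma n))); apply: (mono K).
  apply: Rle_trans Hk _; apply: le_INR; apply: Nat.le_trans (sig_ge n); exact: Nat.le_max_r.
apply: HK => i j; exact: (Hn0 n (Nat.le_max_l _ _) (mkcoord j)).
Qed.

Lemma continuous_bounded_on_box (F : vec m -> R) (x0 : vec m) (B : R) :
  (forall x, filterlim F (nb x) (locally (F x))) ->
  exists K, forall x, (forall i j, Rabs (x i j - x0 i j) <= B) -> Rabs (F x) <= K.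
Proof.
move=> FC; apply: box_uniform => [K K' x KK' H|x]; first by lra.
exists (Rabs (F x) + 1).
have : locally (F x) (fun r => Rabs r <= Rabs (F x) + 1).
  exists (mkposreal 1 Rlt_0_1) => r Hr.
  have {}Hr : Rabs (r - F x) < 1 by exact: Hr.
  by have := Rabs_triang (F x) (r - F x); rewrite Rplus_minus; lra.
exact: FC.
Qed.

Lemma updE x a b t i j : upd x a b t i j =
  if mkcoord j == mkcoord b then t else x i j.
Proof.
rewrite /upd; case: (eqVneq i a) j => [->|ia] j.
- rewrite eqxx /=; case: (eqVneq j b) => [->|jb]; first by rewrite !eqxx.
  rewrite (_ : (_ == _ :> nat) = false); last by apply: negbTE.
  by rewrite (_ : (mkcoord j == _) = false) //; apply: negbTE; rewrite eq_Tagged.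
- rewrite (_ : (_ == _ :> nat) = false) /=; last by apply: negbTE.
  rewrite (_ : (mkcoord j == _) = false) //; apply: negbTE.
  by apply: contraNneq ia => /(congr1 (@tag _ _)) /= ->.
Qed.
End Coordinates.

(** * Differentiation along curves *)

Lemma big_Rabs_le {I : Type} (s : seq I) (F : I -> R) :
  Rabs (\big[Rplus/0]_(c <- s) F c) <= \big[Rplus/0]_(c <- s) Rabs (F c).
Proof.
elim: s => [|c s IH]; first by rewrite !big_nil Rabs_R0; lra.
by rewrite !big_cons; have := Rabs_triang (F c) (\big[Rplus/0]_(c <- s) F c); lra.
Qed.

Lemma big_Rle {I : Type} (s : seq I) (F G : I -> R) :
  (forall c, F c <= G c) -> \big[Rplus/0]_(c <- s) F c <= \big[Rplus/0]_(c <- s) G c.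
Proof.
move=> FG; elim: s => [|c s IH]; first by rewrite !big_nil; lra.
by rewrite !big_cons; have := FG c; lra.
Qed.

Lemma derivable_pt_lim_big {I : Type} (s : seq I) (F : I -> R -> R) (l : I -> R) (t : R) :
  (forall c, derivable_pt_lim (F c) t (l c)) ->
  derivable_pt_lim (fun r => \big[Rplus/0]_(c <- s) F c r) t (\big[Rplus/0]_(c <- s) l c).
Proof.
move=> Fl; elim: s => [|c s IH].
  rewrite big_nil; apply: (derivable_pt_lim_ext (fun _ => 0)); last exact: derivable_pt_lim_const.
  by move=> r; rewrite big_nil.
rewrite big_cons; apply: (derivable_pt_lim_ext (fun r => F c r + \big[Rplus/0]_(c <- s) F c r)).
  by move=> r; rewrite big_cons.
exact: derivable_pt_lim_plus.
Qed.

Lemma derivable_pt_lim_rsum {n : nat} (F : 'I_n -> R -> R) (l : 'I_n -> R) (t : R) :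
  (forall i, derivable_pt_lim (F i) t (l i)) ->
  derivable_pt_lim (fun r => rsum (fun i => F i r)) t (rsum l).
Proof. by move=> Fl; exact: derivable_pt_lim_big. Qed.

Section ChainRule.
Context {N : nat} {m : 'I_N -> nat} (F : vec m -> R) (D : forall a : 'I_N, 'I_(m a) -> vec m -> R).
Hypothesis FD : forall a b x, pd F a b x (D a b x).
Implicit Types x y : vec m.
Let Dc (c : coord) x := D (tag c) (tagged c) x.

(** Intermediate points of a path from [x] to [y] that changes one coordinate at a time. *)
Definition splice (s : seq (@coord N m)) x y : vec m :=
  fun i j => if mkcoord j \in s then y i j else x i j.

Lemma splice_cons (c : coord) s x y :
  splice (c :: s) x y = upd (splice s x y) (tag c) (tagged c) (at_coord y c).
Proof.
apply: functional_extensionality_dep => i; apply: functional_extensionality => j.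
rewrite updE /splice in_cons; case: c => a b /=; rewrite -/(mkcoord b).
by case: eqP => //= E; rewrite -/(at_coord y (mkcoord j)) E.
Qed.

Lemma upd_partial_mvt x (c : coord) (v : R) : exists r,
  Rmin (at_coord x c) v <= r <= Rmax (at_coord x c) v /\
  F (upd x (tag c) (tagged c) v) - F x =
    Dc c (upd x (tag c) (tagged c) r) * (v - at_coord x c).
Proof.
pose h r := F (upd x (tag c) (tagged c) r).
have dh r : derivable_pt_lim h r (Dc c (upd x (tag c) (tagged c) r)).
  have := FD (tag c) (tagged c) (upd x (tag c) (tagged c) r).
  rewrite /pd updE eqxx; apply: derivable_pt_lim_ext => r'.
  congr F; apply: functional_extensionality_dep => i; apply: functional_extensionality => j.
  by rewrite !updE; case: eqP.
have [r [Hr E]] := MVT_gen h (at_coord x c) v (fun r => Dc c (upd x (tag c) (tagged c) r))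
  (fun r _ => proj2 (is_derive_Reals _ _ _) (dh r))
  (fun r _ => derivable_continuous_pt _ _ (exist _ _ (dh r))).
exists r; split=> //; rewrite -E /h; congr (_ - F _).
apply: functional_extensionality_dep => i; apply: functional_extensionality => j.
by rewrite updE; case: eqP => // jc; rewrite -[LHS]/(at_coord x (mkcoord j)) jc.
Qed.

(** The increment is telescoped through the points [splice s x y]. The mean value theorem applies to
    each one-coordinate step, and its intermediate point stays in the sup-norm ball where the
    partial derivatives vary by less than [eps]. *)
Lemma total_differential x (eps : R) : 0 < eps ->
  (forall c, filterlim (Dc c) (nb x) (locally (Dc c x))) ->
  nb x (fun y => Rabs (F y - F x - \big[Rplus/0]_c (Dc c x * (at_coord y c - at_coord x c))) <=
                 eps * \big[Rplus/0]_c Rabs (at_coord y c - at_coord x c)).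
Proof.
move=> eps0 DC.
have : nb x (fun y => forall c, Rabs (Dc c y - Dc c x) < eps).
  apply: filter_all => c; apply: (DC c (fun r => Rabs (r - Dc c x) < eps)).
  by exists (mkposreal eps eps0) => r Hr; exact: Hr.
case=> eta [eta0 Heta]; exists eta; split=> // y Hy.
have main s : uniq s ->
    Rabs (F (splice s x y) - F x - \big[Rplus/0]_(c <- s) (Dc c x * (at_coord y c - at_coord x c)))
    <= eps * \big[Rplus/0]_(c <- s) Rabs (at_coord y c - at_coord x c).
  elim: s => [_|c s IH /= /andP[cs us]].
    have -> : splice [::] x y = x by [].
    by rewrite !big_nil !Rminus_diag Rabs_R0; lra.
  rewrite splice_cons !big_cons.
  have [r [Hr E]] := upd_partial_mvt (splice s x y) c (at_coord y c).
  have sc : at_coord (splice s x y) c = at_coord x c.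
    by case: c cs {Hr E} => a b /negbTE cs; rewrite /at_coord /splice /= /mkcoord cs.
  rewrite sc in Hr E.
  set z := upd _ _ _ r in E.
  have Dz : Rabs (Dc c z - Dc c x) < eps.
    apply: Heta => i j; rewrite /z updE.
    case: eqP => [jc|_].
      have -> : x i j = at_coord x c by rewrite -/(at_coord x (mkcoord j)) jc; case: (c).
      have : Rabs (at_coord y c - at_coord x c) < eta by exact: Hy.
      move: Hr; rewrite /Rmin /Rmax; case: Rle_dec => ? [? ?] /Rabs_lt_between ?;
        apply/Rabs_lt_between; lra.
    rewrite /splice; case: ifP => _; first exact: Hy.
    by rewrite Rminus_diag Rabs_R0.
  have {}IH := IH us.
  set d := at_coord y c - at_coord x c in E *.
  set Sd := \big[Rplus/0]_(_ <- s) (_ * _) in IH *.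
  set Sa := \big[Rplus/0]_(_ <- s) Rabs _ in IH *.
  set G := F (upd _ _ _ (at_coord y c)) in E *.
  have -> : G - F x - (Dc c x * d + Sd) = (Dc c z - Dc c x) * d + (F (splice s x y) - F x - Sd).
    by rewrite /Rminus Rmult_plus_distr_r; rewrite -/z in E; lra.
  have := Rabs_triang ((Dc c z - Dc c x) * d) (F (splice s x y) - F x - Sd).
  rewrite Rabs_mult.
  have : Rabs (Dc c z - Dc c x) * Rabs d <= eps * Rabs d.
    by apply: Rmult_le_compat_r; [exact: Rabs_pos|lra].
  by rewrite Rmult_plus_distr_l; lra.
have := main (index_enum coord) (index_enum_uniq _).
rewrite (_ : splice _ x y = y) //.
apply: functional_extensionality_dep => i; apply: functional_extensionality => j.
by rewrite /splice mem_index_enum.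
Qed.

Lemma chain_rule (X : R -> vec m) (X' : vec m) (t : R) :
  (forall c, filterlim (Dc c) (nb (X t)) (locally (Dc c (X t)))) ->
  (forall i j, derivable_pt_lim (fun r => X r i j) t (X' i j)) ->
  derivable_pt_lim (fun r => F (X r)) t
    (\big[Rplus/0]_(c : coord) (Dc c (X t) * at_coord X' c)).
Proof.
move=> DC dX.
have dXc c : derivable_pt_lim (fun r => at_coord (X r) c) t (at_coord X' c) by exact: dX.
pose L r := \big[Rplus/0]_c (Dc c (X t) * (at_coord (X r) c - at_coord (X t) c)).
have dL : derivable_pt_lim L t (\big[Rplus/0]_c (Dc c (X t) * at_coord X' c)).
  apply: derivable_pt_lim_big => c; apply: derivable_pt_lim_scal.
  rewrite -[X in derivable_pt_lim _ _ X]Rminus_0_r.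
  apply: derivable_pt_lim_minus => //; exact: derivable_pt_lim_const.
pose rem r := F (X r) - F (X t) - L r.
pose C := \big[Rplus/0]_(c : coord) (Rabs (at_coord X' c) + 1).
have Cge0 : 0 <= C.
  rewrite /C; elim/big_ind: _ => [|u v ? ?|c _]; try lra.
  by have := Rabs_pos (at_coord X' c); lra.
have Lt0 : L t = 0.
  by rewrite /L big1 // => c _; rewrite Rminus_diag Rmult_0_r.
have drem : derivable_pt_lim rem t 0.
  move=> eps eps0.
  (* [C * Rabs h] bounds the l1 displacement over a short time [h]; [C + 1] keeps the divisor
     positive and the half makes the last inequality strict. *)
  pose e := eps / (C + 1) / 2.
  have e0 : 0 < e by apply: Rdiv_lt_0_compat; [apply: Rdiv_lt_0_compat|]; lra.
  have lim_X : filterlim X (locally t) (nb (X t)).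
    apply: filterlim_vec => i j.
    exact: (proj1 (continuity_pt_filterlim _ _) (derivable_continuous_pt _ _ (exist _ _ (dX i j)))).
  have [d1 Hd1] := lim_X _ (total_differential (X t) e e0 DC).
  have [d2 Hd2] : locally t (fun r => forall c : coord, Rabs (at_coord (X r) c - at_coord (X t) c) <=
      (Rabs (at_coord X' c) + 1) * Rabs (r - t)).
    apply: filter_all => c; have [d Hd] := dXc c 1 Rlt_0_1.
    exists d => r Hr; case: (Req_dec r t) => [->|rt].
      by rewrite !Rminus_diag Rabs_R0; lra.
    have h0 : r - t <> 0 by lra.
    have := Hd (r - t) h0 Hr; rewrite Rplus_minus => H.
    set q := (_ / _) in H.
    have -> : at_coord (X r) c - at_coord (X t) c = q * (r - t) by rewrite /q; field.
    rewrite Rabs_mult; apply: Rmult_le_compat_r; first exact: Rabs_pos.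
    have := Rabs_triang (at_coord X' c) (q - at_coord X' c); rewrite Rplus_minus; lra.
  exists (mkposreal _ (Rmin_pos _ _ (cond_pos d1) (cond_pos d2))) => h h0 /= Hh.
  have b1 : ball t d1 (t + h).
    by apply: Rlt_le_trans (Rmin_l d1 d2); rewrite /abs /= /minus /plus /opp /= Rplus_comm -Rplus_assoc Rplus_opp_l Rplus_0_l.
  have b2 : ball t d2 (t + h).
    by apply: Rlt_le_trans (Rmin_r d1 d2); rewrite /abs /= /minus /plus /opp /= Rplus_comm -Rplus_assoc Rplus_opp_l Rplus_0_l.
  have H1 := Hd1 _ b1; have H2 := Hd2 _ b2.
  have rt : rem t = 0 by rewrite /rem Lt0; ring.
  rewrite rt !Rminus_0_r Rabs_div //.
  have hp : 0 < Rabs h := Rabs_pos_lt _ h0.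
  apply: (Rmult_lt_reg_r (Rabs h)) => //; rewrite /Rdiv Rmult_assoc Rinv_l; last by lra.
  rewrite Rmult_1_r; apply: Rle_lt_trans H1 _.
  have Hs : \big[Rplus/0]_c Rabs (at_coord (X (t + h)) c - at_coord (X t) c) <= C * Rabs h.
    rewrite /C big_distrl; apply: big_Rle => c.
    have := H2 c; rewrite (_ : t + h - t = h) //; ring.
  apply: Rle_lt_trans (Rmult_le_compat_l _ _ _ (Rlt_le _ _ e0) Hs) _.
  rewrite -Rmult_assoc; apply: Rmult_lt_compat_r => //.
  have : e * (C + 1) = eps / 2 by rewrite /e; field; lra.
  by nra.
apply: (derivable_pt_lim_ext (fun r => rem r + L r + F (X t))).
  by move=> r; rewrite /rem; ring.
rewrite -[X in derivable_pt_lim _ _ X]Rplus_0_r -[X in X + 0]Rplus_0_l.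
apply: derivable_pt_lim_plus; last exact: derivable_pt_lim_const.
exact: derivable_pt_lim_plus.
Qed.
End ChainRule.

(** * Scalar differential inequalities *)

Lemma mvt_from_zero (U U' : R -> R) (r t : R) :
  (forall t, continuity_pt U t) -> (forall t, 0 < t -> derivable_pt_lim U t (U' t)) ->
  0 <= r -> r < t -> exists c, r < c <= t /\ U t - U r = U' c * (t - r).
Proof.
move=> cU dU r0 rt.
(* [MVT_gen] may return the left endpoint, where nothing is known about [U'] *)
pose U'' c := if Rle_dec c r then (U t - U r) / (t - r) + 1 else U' c.
have [||c []] := MVT_gen U r t U''.
- move=> c; rewrite Rmin_left; last by lra.
  rewrite Rmax_right; last by lra.
  move=> [rc _]; rewrite /U''; case: Rle_dec => ? /=; first by lra.
  by apply/is_derive_Reals/dU; lra.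
- by move=> c _; exact: cU.
rewrite Rmin_left; last by lra.
rewrite Rmax_right; last by lra.
move=> rct; rewrite /U''; case: Rle_dec => cr /= E.
  (* In this branch [U''] exceeds the slope of the chord by 1, so it cannot be the mean value. *)
  have : (U t - U r) / (t - r) * (t - r) = U t - U r by field; lra.
  by lra.
by exists c; split=> //; lra.
Qed.

Section Barrier.
Context (U U' : R -> R).
Hypothesis cU : forall t, continuity_pt U t.
Hypothesis dU : forall t, 0 < t -> derivable_pt_lim U t (U' t).

(** If [U t] exceeded [k], then just after the last earlier time [b] with [U b <= k] the values
    would lie strictly inside the band, where [U' <= 0] forbids the rise. *)
Lemma barrier (k k' : R) : k < k' ->
  (forall t, 0 < t -> k < U t < k' -> U' t <= 0) ->
  forall r t, 0 <= r <= t -> U r <= k -> U t <= k.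
Proof.
move=> kk' neg r t [r0 rt] Urk.
case: (Rle_lt_dec (U t) k) => // kUt.
have [b [ub lub]] := completeness (fun z => r <= z <= t /\ U z <= k)
  (ex_intro _ t (fun z H => proj2 (proj1 H))) (ex_intro _ r (conj (conj (Rle_refl r) rt) Urk)).
have rb : r <= b by apply: ub; split=> //; lra.
have bt : b <= t by apply: lub => z [[_ ?] _].
have Ub : U b <= k.
  case: (Rle_lt_dec (U b) k) => // kUb.
  have [d [d0 Hd]] := cU b (U b - k) (Rlt_Rminus _ _ kUb).
  suff : b <= b - d by lra.
  apply: lub => z [[rz zt] Uz]; case: (Rle_lt_dec z (b - d)) => // zb.
  have zleb : z <= b by apply: ub.
  have zneb : b <> z by move=> E; rewrite -E in Uz; lra.
  have := Hd z (conj (conj I zneb) _); rewrite /= /Rdist => H.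
  have {}H := H _; have : Rabs (U z - U b) < U b - k.
    by apply: H; apply/Rabs_lt_between; lra.
  move/Rabs_lt_between; lra.
have [d [d0 Hd]] := cU b (k' - k) (Rlt_Rminus _ _ kk').
have near z : b <= z < b + d -> U z < k'.
  move=> bz; case: (Req_dec b z) => [<-|bnz]; first by lra.
  have := Hd z (conj (conj I bnz) _); rewrite /= /Rdist => H.
  have : Rabs (U z - U b) < k' - k.
    by apply: H; apply/Rabs_lt_between; lra.
  move/Rabs_lt_between; lra.
have blt : b < t by case: bt => // E; rewrite E in Ub; lra.
pose z := Rmin t (b + d / 2).
have bz : b < z by apply: Rmin_glb_lt; lra.
have zt : z <= t by exact: Rmin_l.
have zd : z <= b + d / 2 by exact: Rmin_r.
have above c : b < c -> c <= t -> k < U c.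
  move=> bc ct; case: (Rle_lt_dec (U c) k) => // Uc.
  have cb : c <= b by apply: ub; split=> //; lra.
  lra.
have [c [bcz E]] := mvt_from_zero U U' b z cU dU (Rle_trans _ _ _ r0 rb) bz.
have : U' c <= 0.
  by apply: neg; [lra|split; [apply: above; lra|apply: near; lra]].
have := above z bz zt.
by nra.
Qed.

(* [A u c] reads: [c] is an admissible decay rate at all heights above [u]. *)
Lemma decay_estimate (A : R -> R -> Prop) (lo hi delta : R) :
  0 < delta -> lo < hi -> U 0 < hi -> A lo 0 ->
  (forall u u' c, u <= u' -> A u c -> A u' c) ->
  (forall t c, 0 < t -> lo <= U t < hi -> A (U t) c -> U' t <= - delta * c) ->
  forall t, 0 <= t -> U t <= lo \/ (forall c, A (U t) c -> U t + delta * t * c <= U 0).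
Proof.
move=> d0 lohi U0hi A0 mono rate t t0.
case: (Rle_lt_dec (U t) lo) => [|loUt]; [by left|right].
have A0' u : lo <= u -> A u 0 by move=> ?; apply: mono A0.
have noninc k : lo <= k -> k < hi -> forall r, 0 <= r <= t -> U r <= k -> U t <= k.
  move=> lok khi r rt Ur; apply: (barrier k hi) (rt) Ur => // z z0 Uz.
  by have := rate z 0 z0 _ (A0' _ _); rewrite Rmult_0_r; apply; lra.
have below_hi z : 0 <= z -> U z < hi.
  move=> z0; pose k := Rmax lo (U 0).
  have k1 : lo <= k by exact: Rmax_l.
  have k2 : U 0 <= k by exact: Rmax_r.
  have k3 : k < hi by apply: Rmax_lub_lt.
  suff : U z <= k by lra.
  apply: (barrier k hi k3) (conj (Rle_refl 0) z0) k2 => y y0 Uy.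
  by have := rate y 0 y0 _ (A0' _ _); rewrite Rmult_0_r; apply; lra.
(* Since [U t] lies above [lo], no earlier value is below [U t]; a rate admissible at height [U t]
   is therefore admissible on all of [[0, t]]. *)
have ge z : 0 <= z <= t -> U t <= U z.
  move=> zt; case: (Rle_lt_dec (U t) (U z)) => // lt.
  have := noninc (Rmax lo (U z)) (Rmax_l _ _) _ z zt (Rmax_r _ _).
  have : Rmax lo (U z) < U t by apply: Rmax_lub_lt.
  have := below_hi t t0 => H1 H2 H3; have := H3 _; lra.
move=> c Ac.
case: t0 => [t0|<-]; last by lra.
have [z [zt E]] := mvt_from_zero U U' 0 t cU dU (Rle_refl 0) t0.
have Uz : U t <= U z by apply: ge; lra.
have : U' z <= - delta * c.
  apply: rate; [lra| |exact: mono Ac].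
  by split; [lra|apply: below_hi; lra].
by move=> H; rewrite Rminus_0_r in E; nra.
Qed.
End Barrier.

(** * The class-KL bound *)

Section DecayBound.
Context (A : R -> R -> Prop).
Hypothesis A_mono : forall u u' c, u <= u' -> A u c -> A u' c.
Hypothesis A_zero : forall u, 0 <= u -> A u 0.
Hypothesis A_at0 : forall c, A 0 c -> c <= 0.
Hypothesis A_pos : forall u, 0 < u -> exists c, 0 < c /\ A u c.

(** The heights that the decay inequalities leave possible at rescaled time [s] after a start at
    height [r]; [beta r s] will be their supremum. *)
Let reachable (r s u : R) := 0 <= u /\ forall c, A u c -> u + s * c <= r.

Lemma decay_bound_exists : exists beta : R -> R -> R,
  (forall r s, 0 <= r -> 0 <= s -> 0 <= beta r s <= r) /\
  (forall r s u, 0 <= r -> 0 <= s -> 0 <= u -> (forall c, A u c -> u + s * c <= r) ->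
     u <= beta r s) /\
  (forall r r' s, 0 <= r <= r' -> 0 <= s -> beta r s <= beta r' s <= beta r s + (r' - r)) /\
  (forall r s s', 0 <= r -> 0 <= s <= s' -> beta r s' <= beta r s) /\
  (forall r eps, 0 <= r -> 0 < eps -> exists S, forall s, S <= s -> beta r s <= eps).
Proof.
have ex (rs : R * R) : exists b, 0 <= rs.1 -> 0 <= rs.2 -> is_lub (reachable rs.1 rs.2) b.
  case: rs => r s /=.
  case: (Rle_lt_dec 0 r) => [r0|]; last by exists 0; lra.
  case: (Rle_lt_dec 0 s) => [s0|]; last by exists 0; lra.
  have [||b Hb] := completeness (reachable r s); last by exists b.
  - by exists r => u [u0 Hu]; have := Hu 0 (A_zero u u0); lra.
  - by exists 0; split=> [|c /A_at0]; [lra|nra].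
have [b Hb] := functional_choice _ ex.
pose beta r s := b (r, s).
have lub r s : 0 <= r -> 0 <= s -> is_lub (reachable r s) (beta r s) by exact: (Hb (r, s)).
have reach0 r s : 0 <= r -> 0 <= s -> reachable r s 0.
  by move=> r0 s0; split=> [|c /A_at0]; [lra|nra].
have mono r r' s : 0 <= r <= r' -> 0 <= s -> beta r s <= beta r' s.
  move=> rr' s0; apply: (proj2 (lub r s _ _)); try lra.
  move=> u [u0 Hu]; apply: (proj1 (lub r' s _ _)); try lra.
  by split=> // c /Hu; lra.
exists beta; split; [|split; [|split; [|split]]].
- move=> r s r0 s0; split; first by apply: (proj1 (lub r s r0 s0)); exact: reach0.
  apply: (proj2 (lub r s r0 s0)) => u [u0 Hu]; have := Hu 0 (A_zero u u0); lra.
- by move=> r s u r0 s0 u0 Hu; apply: (proj1 (lub r s r0 s0)).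
- move=> r r' s rr' s0; split; first exact: mono.
  apply: (proj2 (lub r' s _ _)); try lra.
  (* Lowering [u] by [r' - r] compensates the lower start, because a rate admissible at the lower
     height is admissible at [u]. Hence [beta] is 1-Lipschitz in [r] whatever the relation [A]. *)
  move=> u [u0 Hu]; case: (Rle_lt_dec u (r' - r)) => ur.
    suff : 0 <= beta r s by lra.
    by apply: (proj1 (lub r s _ _)); try lra; apply: reach0; lra.
  suff : u - (r' - r) <= beta r s by lra.
  apply: (proj1 (lub r s _ _)); try lra; split; first by lra.
  by move=> c Ac; have := Hu c (A_mono _ u c _ Ac); lra.
- move=> r s s' r0 ss'; apply: (proj2 (lub r s' _ _)); try lra.
  move=> u [u0 Hu]; apply: (proj1 (lub r s _ _)); try lra; split=> // c Ac.
  have := Hu c Ac; have := Hu 0 (A_zero u u0).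
  by case: (Rle_lt_dec 0 c) => c0; nra.
- move=> r eps r0 eps0; have [c [c0 Ac]] := A_pos eps eps0.
  (* A height above [eps] descends at rate at least [c], so by time [r / c] it would have lost more
     than the start allows. *)
  exists (r / c + 1) => s Ss.
  have rc : 0 <= r / c by apply: Rdiv_le_0_compat.
  apply: (proj2 (lub r s _ _)); try lra.
  move=> u [u0 Hu]; case: (Rle_lt_dec u eps) => // epsu.
  have := Hu c (A_mono _ _ _ (Rlt_le _ _ epsu) Ac).
  have : r / c * c = r by field; lra.
  by nra.
Qed.

(** Passes from energies to norms: [k] bounds the initial energy by the squared norm, [k'] bounds
    the squared norm by the final energy. *)
Lemma classKL_from_decay (k k' : R) : 0 < k -> 0 < k' ->
  exists phi, classKL phi /\
    forall r s u, 0 <= r -> 0 <= s -> 0 <= u ->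
      (forall c, A u c -> u + s * c <= k * r ^ 2) -> sqrt (k' * u) <= phi r s.
Proof.
move=> k0 k'0.
have [beta [bnd [sup [lip [dec lim]]]]] := decay_bound_exists.
have kr r : 0 <= k * r ^ 2 by apply: Rmult_le_pos; [lra|exact: pow2_ge_0].
have krm r r' : 0 <= r <= r' -> k * r ^ 2 <= k * r' ^ 2.
  by move=> rr'; apply: Rmult_le_compat_l; [lra|apply: pow_incr].
(* [beta] is only nondecreasing in [r]; the added term supplies strict monotonicity and vanishes as
   [s] grows. *)
pose phi r s := sqrt (k' * beta (k * r ^ 2) s) + r * / (1 + s).
exists phi; split; last first.
  move=> r s u r0 s0 u0 Hu.
  have H : u <= beta (k * r ^ 2) s by apply: sup.
  have := sqrt_le_1_alt _ _ (Rmult_le_compat_l _ _ _ (Rlt_le _ _ k'0) H).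
  have : 0 <= r * / (1 + s) by apply: Rmult_le_pos => //; apply/Rlt_le/Rinv_0_lt_compat; lra.
  by rewrite /phi; lra.
split.
- move=> s s0; split; [|split].
  + rewrite /phi (_ : k * 0 ^ 2 = 0); last by ring.
    have := bnd 0 s (Rle_refl 0) s0 => b0; have -> : beta 0 s = 0 by lra.
    by rewrite Rmult_0_r sqrt_0; ring.
  + move=> r r0.
    (* [beta] is controlled for a nonnegative first argument only; truncating by [Rmax 0] gives a
       function continuous in the two-sided sense. *)
    have cb z : 0 <= z -> continuity_pt (fun y => beta (Rmax 0 y) s) z.
      move=> z0 e e0; exists e; split=> // y [_ /= Hy].
      rewrite /Rdist in Hy *; apply: Rle_lt_trans Hy.
      have M y' : 0 <= Rmax 0 y' by exact: Rmax_l.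
      case: (Rle_lt_dec y z) => yz.
      * have H : Rmax 0 y <= Rmax 0 z by apply: Rle_max_compat_l; lra.
        have := lip _ _ s (conj (M y) H) s0 => L.
        have : Rmax 0 z - Rmax 0 y <= z - y by rewrite /Rmax; case: Rle_dec => ?; case: Rle_dec => ?; lra.
        by rewrite !Rabs_left1; lra.
      * have H : Rmax 0 z <= Rmax 0 y by apply: Rle_max_compat_l; lra.
        have := lip _ _ s (conj (M z) H) s0 => L.
        have : Rmax 0 y - Rmax 0 z <= y - z by rewrite /Rmax; case: Rle_dec => ?; case: Rle_dec => ?; lra.
        by rewrite !Rabs_right; lra.
    pose psi r := sqrt (k' * beta (Rmax 0 (k * r ^ 2)) s) + r * / (1 + s).
    have psiE z : psi z = phi z s by rewrite /psi Rmax_right.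
    have : continuity_pt psi r.
      apply: continuity_pt_plus.
        apply: (continuity_pt_comp (fun r => k' * beta (Rmax 0 (k * r ^ 2)) s) sqrt).
          apply: continuity_pt_scal.
          apply: (continuity_pt_comp (fun r => k * r ^ 2) (fun y => beta (Rmax 0 y) s)).
            by reg.
          by apply: cb; exact: kr.
        by apply/continuity_pt_filterlim; exact: continuous_sqrt.
      by reg.
    move=> H eps eps0; have [d [d0 Hd]] := H eps eps0.
    exists d; split=> // r' r'0 Hr'.
    case: (Req_dec r r') => [->|rr']; first by rewrite Rminus_diag Rabs_R0.
    by have := Hd r' (conj (conj I rr') Hr'); rewrite !psiE.
  + move=> r1 r2 r10 r12.
    have [L _] := lip _ _ s (conj (kr r1) (krm r1 r2 (conj r10 (Rlt_le _ _ r12)))) s0.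
    have := sqrt_le_1_alt _ _ (Rmult_le_compat_l _ _ _ (Rlt_le _ _ k'0) L).
    have : r1 * / (1 + s) < r2 * / (1 + s).
      by apply: Rmult_lt_compat_r => //; apply: Rinv_0_lt_compat; lra.
    by rewrite /phi; lra.
- move=> r r0; split.
  + move=> s1 s2 s10 s12; rewrite /phi.
    have L := dec (k * r ^ 2) _ _ (kr r) (conj s10 s12).
    have := sqrt_le_1_alt _ _ (Rmult_le_compat_l _ _ _ (Rlt_le _ _ k'0) L).
    have : r * / (1 + s2) <= r * / (1 + s1).
      by apply: Rmult_le_compat_l => //; apply: Rinv_le_contravar; lra.
    by lra.
  + move=> eps eps0.
    have e1 : 0 < (eps / 2) ^ 2 / k' / 2.
      by apply: Rdiv_lt_0_compat; [apply: Rdiv_lt_0_compat => //; apply: pow_lt|]; lra.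
    have [S HS] := lim (k * r ^ 2) _ (kr r) e1.
    (* The second threshold makes [r / (1 + s)] less than [eps / 2]; being positive, it also yields
       [0 <= s]. *)
    exists (Rmax S (2 * (r + 1) / eps)) => s Hs.
    have sS : S <= s by apply: Rle_trans Hs; exact: Rmax_l.
    have sr : 2 * (r + 1) / eps <= s by apply: Rle_trans Hs; exact: Rmax_r.
    have q0 : 0 < 2 * (r + 1) / eps by apply: Rdiv_lt_0_compat; lra.
    have b := HS s sS; have b0 := bnd (k * r ^ 2) s (kr r) (Rlt_le _ _ (Rlt_le_trans _ _ _ q0 sr)).
    have t1 : sqrt (k' * beta (k * r ^ 2) s) < eps / 2.
      rewrite -(sqrt_pow2 (eps / 2)); last by lra.
      apply: sqrt_lt_1; [by apply: Rmult_le_pos; lra|exact: pow2_ge_0|].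
      apply: Rle_lt_trans (Rmult_le_compat_l _ _ _ (Rlt_le _ _ k'0) b) _.
      have -> : k' * ((eps / 2) ^ 2 / k' / 2) = (eps / 2) ^ 2 / 2 by field; lra.
      have : 0 < (eps / 2) ^ 2 by apply: pow_lt; lra.
      by move=> ?; lra.
    have t2 : r * / (1 + s) < eps / 2.
      apply: (Rmult_lt_reg_r (1 + s)); first by lra.
      rewrite Rmult_assoc Rinv_l; last by lra.
      have : 2 * (r + 1) / eps * eps = 2 * (r + 1) by field; lra.
      by nra.
    have p1 := sqrt_pos (k' * beta (k * r ^ 2) s).
    have p2 : 0 <= r * / (1 + s).
      by apply: Rmult_le_pos => //; apply/Rlt_le/Rinv_0_lt_compat; lra.
    by rewrite /phi Rabs_right; lra.
Qed.
End DecayBound.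

(** * Continuity and derivative of the variation *)

Lemma filterlim_Rscal {T : Type} (Phi : (T -> Prop) -> Prop) {FPhi : Filter Phi}
    (c : R) (f : T -> R) (l : R) :
  filterlim f Phi (locally l) -> filterlim (fun t => c * f t) Phi (locally (c * l)).
Proof. by move=> fl; apply: filterlim_Rmult (filterlim_const c) fl. Qed.

Lemma filterlim_sqr {T : Type} (Phi : (T -> Prop) -> Prop) {FPhi : Filter Phi}
    (f : T -> R) (l : R) :
  filterlim f Phi (locally l) -> filterlim (fun t => f t ^ 2) Phi (locally (l ^ 2)).
Proof.
move=> fl /=; apply: filterlim_Rmult (fl) _; apply: filterlim_Rmult fl _.
exact: filterlim_const.
Qed.

(** Convergence is asked on [S] alone because [solution] constrains [w] on the neighbourhoods
    alone. *)
Lemma filterlim_variation {T : Type} (Phi : (T -> Prop) -> Prop) {FPhi : Filter Phi}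
    {p : nat} (S : 'I_p -> Prop) (g : T -> 'I_p -> R) (l : 'I_p -> R) :
  (forall j, S j -> filterlim (fun t => g t j) Phi (locally (l j))) ->
  filterlim (fun t => variation S (g t)) Phi (locally (variation S l)).
Proof.
move=> gl.
have gl' (h : 'I_p -> T -> R) (lh : 'I_p -> R) :
    (forall j, S j -> filterlim (h j) Phi (locally (lh j))) ->
    filterlim (fun t => rsum (fun j => ind (S j) * h j t)) Phi (locally (rsum (fun j => ind (S j) * lh j))).
  move=> hl; apply: filterlim_rsum => j.
  case: (excluded_middle_informative (S j)) => Sj; first by apply: filterlim_Rscal; exact: hl.
  rewrite ind_false // Rmult_0_l; apply: (filterlim_ext (fun _ => 0)) => [t|].
    by rewrite Rmult_0_l.
  exact: filterlim_const.
apply: (gl' (fun j t => (g t j - rsum (fun l => ind (S l) * g t l) / rsum (fun j => ind (S j))) ^ 2)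
   (fun j => (l j - rsum (fun k => ind (S k) * l k) / rsum (fun j => ind (S j))) ^ 2)) => j Sj.
apply: filterlim_sqr; apply: filterlim_Rminus; first exact: gl.
apply: filterlim_Rmult; last exact: filterlim_const.
exact: (gl' (fun j t => g t j)).
Qed.

(** The expanded form in [variationE] is differentiated; the two resulting sums recombine into
    deviations from the mean. *)
Lemma derivable_pt_lim_variation {p : nat} (S : 'I_p -> Prop) (g : R -> 'I_p -> R)
    (g' : 'I_p -> R) (t : R) :
  0 < rsum (fun j => ind (S j)) ->
  (forall j, S j -> derivable_pt_lim (fun r => g r j) t (g' j)) ->
  derivable_pt_lim (fun r => variation S (g r)) t
    (2 * rsum (fun j => ind (S j) *
      (g t j - rsum (fun l => ind (S l) * g t l) / rsum (fun j => ind (S j))) * g' j)).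
Proof.
set n := rsum _ => n0 dg.
have dsum (h : 'I_p -> R -> R) (h' : 'I_p -> R) :
    (forall j, S j -> derivable_pt_lim (h j) t (h' j)) ->
    derivable_pt_lim (fun r => rsum (fun j => ind (S j) * h j r)) t (rsum (fun j => ind (S j) * h' j)).
  move=> hl; apply: derivable_pt_lim_rsum => j.
  case: (excluded_middle_informative (S j)) => Sj; first by apply: derivable_pt_lim_scal; exact: hl.
  rewrite ind_false // Rmult_0_l; apply: (derivable_pt_lim_ext (fun _ => 0)) => [r|].
    by rewrite Rmult_0_l.
  exact: derivable_pt_lim_const.
have sqr (h : R -> R) h' : derivable_pt_lim h t h' ->
    derivable_pt_lim (fun r => h r ^ 2) t (2 * h t * h').
  move=> dh; have := derivable_pt_lim_mult h h t h' h' dh dh.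
  rewrite (_ : h' * h t + h t * h' = 2 * h t * h'); last by ring.
  by apply: derivable_pt_lim_ext => r; rewrite /mult_fct /=; ring.
apply: (derivable_pt_lim_ext (fun r => rsum (fun j => ind (S j) * g r j ^ 2) -
    / n * (rsum (fun j => ind (S j) * g r j)) ^ 2)).
  by move=> r; rewrite variationE // /Rdiv -/n; ring.
have d1 := dsum (fun j r => g r j ^ 2) (fun j => 2 * g t j * g' j) (fun j Sj => sqr _ _ (dg j Sj)).
have d2 := sqr _ _ (dsum (fun j r => g r j) g' dg).
have := derivable_pt_lim_minus _ _ _ _ _ d1 (derivable_pt_lim_scal _ (/ n) _ _ d2).
set p0 := rsum (fun j => ind (S j) * g t j).
rewrite (_ : 2 * rsum _ = rsum (fun j => ind (S j) * (2 * g t j * g' j)) -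
  / n * (2 * p0 * rsum (fun j => ind (S j) * g' j))) //.
clearbody p0; rewrite -!rsum_mull -rsum_sub; apply: rsum_ext => j; rewrite /Rdiv; ring.
Qed.

(** * The game: pseudo-gradient, Lyapunov function and dissipation *)

Section Game.
Context {N : nat} {m : 'I_N -> nat} (f : costs m) (xs : vec m) (dbar : vec m) (df : dercost m).
Hypothesis A1 : AssumptionA1 f.
Hypothesis A2 : AssumptionA2 f.
Hypothesis nash : Nash f xs.
Hypothesis dbar_gt0 : forall i j, 0 < dbar i j.
Hypothesis dfE : forall i j k x, pd (f i j) i k x (df i j k x).

Definition partial_grad (x : vec m) : vec m := fun i k => rsum (fun j => df i j k x).
Definition nbhd_size (i : 'I_N) (k : 'I_(m i)) : R := rsum (fun j => ind (inS f i k j)).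

Lemma nbhd_size_ge1 i k : 1 <= nbhd_size i k.
Proof.
rewrite -(ind_true (inS f i k k)); last by left.
by apply: (rsum_ge_term (fun j => ind (inS f i k j))) => j; exact: ind_ge0.
Qed.

Lemma df_outside i k j x : ~ inS f i k j -> df i j k x = 0.
Proof.
move=> nS; apply: uniqueness_limite (dfE i j k x) _.
apply: (derivable_pt_lim_ext (fun _ => f i j x)); last exact: derivable_pt_lim_const.
move=> t; apply: NNPP => ne; apply: nS.
case: (classic (j = k)) => [->|jk]; first by left.
by right; split; [exact: nesym|right; exists x, t; exact: nesym].
Qed.

(** The costs outside the neighbourhood of [k] do not depend on [x_ik], so the agents that run the
    consensus on [k] carry the whole gradient. *)
Lemma partial_gradE x i k : partial_grad x i k = rsum (fun j => ind (inS f i k j) * df i j k x).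
Proof.
apply: rsum_ext => j; case: (classic (inS f i k j)) => [Sj|nS].
  by rewrite ind_true // Rmult_1_l.
by rewrite ind_false // df_outside // Rmult_0_l.
Qed.

Lemma partial_grad_correct : pseudo_grad f partial_grad.
Proof. by move=> x i k; apply: derivable_pt_lim_rsum => j; exact: dfE. Qed.

(** Moving a single coordinate is a unilateral deviation of its coalition, so the derivative
    vanishes at the minimum. *)
Lemma partial_grad_nash i k : partial_grad xs i k = 0.
Proof.
have d := partial_grad_correct xs i k.
pose h t := fc f i (upd xs i k t).
have updK : upd xs i k (xs i k) = xs.
  apply: functional_extensionality_dep => i'; apply: functional_extensionality => j'.
  rewrite updE; case: eqP => // E.
  by rewrite -[LHS]/(at_coord xs (mkcoord k)) -E.
have hmin t : h (xs i k) <= h t.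
  rewrite /h updK; apply: Rle_trans (nash i (upd xs i k t)) _; apply: Req_le; congr fc.
  apply: functional_extensionality_dep => i'; apply: functional_extensionality => j'.
  rewrite /blend; case: eqP => // /eqP ne; rewrite updE; case: eqP => // E.
  by case/eqP: ne; have := congr1 (@tag _ _) E => /= ->.
have pr : derivable_pt h (xs i k) by exists (partial_grad xs i k).
have := deriv_minimum h (xs i k - 1) (xs i k + 1) (xs i k) pr _ _ (fun t _ _ => hmin t).
by rewrite (derive_pt_eq_0 _ _ _ pr d); apply; lra.
Qed.

Lemma df_continuous i j k x : filterlim (df i j k) (nb x) (locally (df i j k x)).
Proof.
have [D1 [_ [_ [HD1 [_ [cD1 _]]]]]] := A1 i j.
have -> : df i j k = D1 i k.
  apply: functional_extensionality => y; exact: uniqueness_limite (dfE i j k y) (HD1 i k y).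
by apply: contv_filterlim; exact: cD1.
Qed.

Lemma partial_grad_continuous i k x :
  filterlim (fun y => partial_grad y i k) (nb x) (locally (partial_grad x i k)).
Proof. by apply: filterlim_rsum => j; exact: df_continuous. Qed.

(** The second partial derivatives are bounded on the box. The constant depends on the box and not
    on the curve, so the forcing of the [g]-values inherits the factor [delta] of the speed. *)
Lemma df_speed_bound i j k (B : R) : exists K, forall (X : R -> vec m) (X' : vec m) t M,
  (forall a b, Rabs (X t a b - xs a b) <= B) ->
  (forall a b, derivable_pt_lim (fun r => X r a b) t (X' a b)) ->
  0 <= M -> (forall a b, Rabs (X' a b) <= M) ->
  exists l, derivable_pt_lim (fun r => df i j k (X r)) t l /\ Rabs l <= K * M.
Proof.
have [D1 [D2 [_ [HD1 [HD2 [_ cD2]]]]]] := A1 i j.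
have E : df i j k = D1 i k.
  apply: functional_extensionality => y; exact: uniqueness_limite (dfE i j k y) (HD1 i k y).
pose P (c : @coord N m) K := forall x, (forall a b, Rabs (x a b - xs a b) <= B) ->
  Rabs (D2 i k (tag c) (tagged c) x) <= K.
have [||K [K0 HK]] := finite_bound P.
- by move=> c K K' KK' H x Hx; apply: Rle_trans (H x Hx) KK'.
- by move=> c; apply: continuous_bounded_on_box => x; apply: contv_filterlim; exact: cD2.
exists (\big[Rplus/0]_(c : @coord N m) K) => X X' t M Hx dX M0 HX'; rewrite E.
have d := chain_rule (D1 i k) (D2 i k) (HD2 i k) X X' t
  (fun c => contv_filterlim _ _ (cD2 _ _ _ _)) dX.
eexists; split; first exact: d.
apply: Rle_trans (big_Rabs_le _ _) _; rewrite big_distrl; apply: big_Rle => c /=.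
rewrite Rabs_mult; apply: Rmult_le_compat; [exact: Rabs_pos|exact: Rabs_pos| |exact: HX'].
exact: (HK c).
Qed.

(** To leading order [x_ik] moves with velocity [- delta * dbar_ik * P_ik / n_ik]; this weight
    cancels both [dbar_ik] and [n_ik] in the derivative of [lyap]. *)
Definition lyap_coef (i : 'I_N) (k : 'I_(m i)) : R := nbhd_size i k / (2 * dbar i k).
Definition lyap (x : vec m) : R :=
  rsum (fun i => rsum (fun k => lyap_coef i k * (x i k - xs i k) ^ 2)).
Definition dissipation (x : vec m) : R := inner (vdiff x xs) (partial_grad x).

Lemma lyap_coef_gt0 i k : 0 < lyap_coef i k.
Proof.
have := nbhd_size_ge1 i k; have := dbar_gt0 i k => ? ?.
by apply: Rdiv_lt_0_compat; lra.
Qed.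

Lemma lyap_sqnorm : exists K, 1 <= K /\
  forall x, lyap x <= K * sqnorm (vdiff x xs) /\ sqnorm (vdiff x xs) <= K * lyap x.
Proof.
pose P (c : @coord N m) K := lyap_coef (tag c) (tagged c) <= K /\ 1 <= K * lyap_coef (tag c) (tagged c).
have [||K [K0 HK]] := finite_bound P.
- move=> c K K' KK' [H1 H2]; have := lyap_coef_gt0 (tag c) (tagged c) => ?.
  split; first by lra.
  by apply: Rle_trans H2 _; apply: Rmult_le_compat_r; lra.
- move=> c; have c0 := lyap_coef_gt0 (tag c) (tagged c).
  set q := lyap_coef _ _ in c0 *.
  have q0 : 0 < / q by exact: Rinv_0_lt_compat.
  exists (q + / q); rewrite /P -/q; split; first by lra.
  have : / q * q = 1 by field; lra.
  nra.
exists (K + 1); split; first by lra.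
move=> x; rewrite /sqnorm -!rsum_mull; split; apply: rsum_le => i; rewrite -rsum_mull.
- apply: rsum_le => k; apply: Rmult_le_compat_r; first exact: pow2_ge_0.
  by have := proj1 (HK (mkcoord k)); rewrite /=; lra.
- apply: rsum_le => k; rewrite /vdiff -Rmult_assoc -[X in X <= _]Rmult_1_l.
  apply: Rmult_le_compat_r; first exact: pow2_ge_0.
  have := proj2 (HK (mkcoord k)); have := lyap_coef_gt0 i k; rewrite /=; lra.
Qed.

Lemma lyap_ge0 x : 0 <= lyap x.
Proof.
apply: rsum_ge0 => i; apply: rsum_ge0 => k; apply: Rmult_le_pos; last exact: pow2_ge_0.
exact/Rlt_le/lyap_coef_gt0.
Qed.

Lemma lyap_xs : lyap xs = 0.
Proof.
rewrite /lyap /rsum big1 // => i _; rewrite big1 // => k _.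
by rewrite Rminus_diag /=; ring.
Qed.

(** The inequality [|y| <= 1 + y ^ 2] avoids a square root. *)
Lemma lyap_coord_bound : exists K, 0 <= K /\
  forall x u, lyap x <= u -> forall i j, Rabs (x i j - xs i j) <= 1 + K * u.
Proof.
have [K [K1 HK]] := lyap_sqnorm; exists K; split; first by lra.
move=> x u xu i j; have [_ H] := HK x; have := sqnorm_term (vdiff x xs) i j.
rewrite -pow2_abs {1}/vdiff => H1.
have : K * lyap x <= K * u by apply: Rmult_le_compat_l; lra.
by have := Rabs_pos (x i j - xs i j); nra.
Qed.

Lemma lyap_continuous x : filterlim lyap (nb x) (locally (lyap x)).
Proof.
apply: filterlim_rsum => i; apply: filterlim_rsum => k; apply: filterlim_Rscal.
apply: filterlim_sqr; apply: filterlim_Rminus; first exact: filterlim_coord.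
exact: filterlim_const.
Qed.

Lemma dissipation_continuous x : filterlim dissipation (nb x) (locally (dissipation x)).
Proof.
apply: filterlim_rsum => i; apply: filterlim_rsum => k; apply: filterlim_Rmult.
  apply: filterlim_Rminus; first exact: filterlim_coord.
  exact: filterlim_const.
exact: partial_grad_continuous.
Qed.

Lemma inner_mull (c : R) (x y : vec m) : inner (fun i j => c * x i j) y = c * inner x y.
Proof.
rewrite /inner -rsum_mull; apply: rsum_ext => i; rewrite -rsum_mull.
by apply: rsum_ext => j; ring.
Qed.

Lemma inner_subr (x y z : vec m) : inner x (vdiff y z) = inner x y - inner x z.
Proof.
rewrite /inner -rsum_sub; apply: rsum_ext => i; rewrite -rsum_sub.
by apply: rsum_ext => j; rewrite /vdiff; ring.
Qed.

Lemma partial_grad_monotone x y : (exists i j, x i j <> y i j) ->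
  0 < inner (vdiff x y) (vdiff (partial_grad x) (partial_grad y)).
Proof. exact: A2 partial_grad_correct x y. Qed.

Lemma inner_partial_grad_xs (y : vec m) : inner y (partial_grad xs) = 0.
Proof.
rewrite /inner /rsum big1 // => i _; rewrite big1 // => k _.
by rewrite partial_grad_nash Rmult_0_r.
Qed.

Lemma dissipation_gt0 x : (exists i j, x i j <> xs i j) -> 0 < dissipation x.
Proof.
move=> /partial_grad_monotone; rewrite inner_subr inner_partial_grad_xs Rminus_0_r.
exact.
Qed.

Lemma dissipation_ge0 x : 0 <= dissipation x.
Proof.
case: (classic (exists i j, x i j <> xs i j)) => [/dissipation_gt0 /Rlt_le //|nex].
have -> : x = xs.
  apply: functional_extensionality_dep => i; apply: functional_extensionality => j.
  by apply: NNPP => ne; apply: nex; exists i, j.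
rewrite /dissipation inner_partial_grad_xs; lra.
Qed.

(* Monotonicity of the pseudo-gradient, applied to two points of a ray from [xs]. *)
Lemma dissipation_ray x (t : R) : 0 < t <= 1 ->
  dissipation (fun i j => xs i j + t * (x i j - xs i j)) <= dissipation x.
Proof.
move=> [t0 t1]; set z : vec m := fun i j => _.
have dz : dissipation z = t * inner (vdiff x xs) (partial_grad z).
  rewrite -inner_mull /dissipation; congr inner.
  apply: functional_extensionality_dep => i; apply: functional_extensionality => j.
  by rewrite /vdiff /z; ring.
have z0 := dissipation_ge0 z.
case: (classic (exists i j, x i j <> z i j)) => [/partial_grad_monotone|nex].
  have -> : vdiff x z = (fun i j => (1 - t) * vdiff x xs i j).
    apply: functional_extensionality_dep => i; apply: functional_extensionality => j.
    by rewrite /vdiff /z; ring.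
  rewrite inner_mull inner_subr -/(dissipation x).
  (* [dissipation z = t * q <= q], and monotonicity between [x] and [z] gives
     [q < dissipation x]. *)
  set q := inner _ _ in dz *; have q0 : 0 <= q by nra.
  move=> pos; have : 0 < dissipation x - q by nra.
  by nra.
suff -> : x = z by lra.
apply: functional_extensionality_dep => i; apply: functional_extensionality => j.
by apply: NNPP => ne; apply: nex; exists i, j.
Qed.

(** Compactness gives the bound on the level set [lyap = u]; a point of higher level is moved down
    its ray to that set, which does not increase the dissipation. *)
Lemma dissipation_lower_bound (u : R) : 0 < u ->
  exists c, 0 < c /\ forall x, u <= lyap x -> c <= dissipation x.
Proof.
move=> u0.
have [KV [KV0 HKV]] := lyap_coord_bound.
(* The box contains the level set; near a point off the level set the property holds vacuously. *)
have [||K HK] := box_uniform xs (1 + KV * u) (fun K x => lyap x = u -> 1 <= K * dissipation x).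
- move=> K K' x KK' H /H H1; have := dissipation_ge0 x; nra.
- move=> x; case: (Req_dec (lyap x) u) => [xu|xu].
    have dx : 0 < dissipation x.
      apply: dissipation_gt0; apply: NNPP => nex.
      have E : x = xs.
        apply: functional_extensionality_dep => i; apply: functional_extensionality => j.
        by apply: NNPP => ne; apply: nex; exists i, j.
      by rewrite E lyap_xs in xu; lra.
    exists (2 / dissipation x).
    have H : locally (dissipation x) (fun r => dissipation x / 2 < r).
      have h0 : 0 < dissipation x / 2 by lra.
      exists (mkposreal _ h0) => r Hr.
      have {Hr} /Rabs_lt_between ? : Rabs (r - dissipation x) < dissipation x / 2 by exact: Hr.
      lra.
    have {}H : nb x (fun y => dissipation x / 2 < dissipation y) := dissipation_continuous x _ H.
    apply: filter_imp H => y Hy _.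
    have : 2 / dissipation x * (dissipation x / 2) = 1 by field; lra.
    have : 0 < 2 / dissipation x by apply: Rdiv_lt_0_compat; lra.
    by nra.
  exists 0.
  have H : locally (lyap x) (fun r => r <> u).
    have h0 : 0 < Rabs (lyap x - u) by apply: Rabs_pos_lt; lra.
    exists (mkposreal _ h0) => r Hr ru.
    have : Rabs (r - lyap x) < Rabs (lyap x - u) by exact: Hr.
    by rewrite ru Rabs_minus_sym; lra.
  have {}H : nb x (fun y => lyap y <> u) := lyap_continuous x _ H.
  by apply: filter_imp H => y Hy.
have K10 : 0 < Rmax K 1 by have := Rmax_r K 1; lra.
exists (/ Rmax K 1); split; first exact: Rinv_0_lt_compat.
(* [lyap] is quadratic along rays from [xs], so this factor lands exactly on level [u]. *)
move=> x ux; pose t := sqrt (u / lyap x).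
have lx : 0 < lyap x by lra.
have ul : 0 < u / lyap x by exact: Rdiv_lt_0_compat.
have t0 : 0 < t by exact: sqrt_lt_R0.
have tt : t ^ 2 = u / lyap x by rewrite /t pow2_sqrt //; lra.
have ul1 : u / lyap x <= 1.
  apply: (Rmult_le_reg_r (lyap x)) => //; rewrite Rmult_1_l /Rdiv Rmult_assoc Rinv_l; lra.
have t1 : t <= 1 by nra.
apply: Rle_trans (dissipation_ray x t (conj t0 t1)).
set z : vec m := fun i j => _.
have zu : lyap z = u.
  have -> : lyap z = t ^ 2 * lyap x.
    rewrite /lyap -rsum_mull; apply: rsum_ext => i; rewrite -rsum_mull.
    by apply: rsum_ext => k; rewrite /z; ring.
  by rewrite tt; field; lra.
have := HK z (HKV z u (Req_le _ _ zu)) zu => H.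
have d0 := dissipation_ge0 z; have := Rmax_l K 1 => ?.
apply: (Rmult_le_reg_l (Rmax K 1)) => //; rewrite Rinv_r; last by lra.
by nra.
Qed.
End Game.

(** * Energy estimate along the seeking dynamics *)

(** With [q] of order [delta], half of the consensus decay absorbs the linear term and leaves one of
    order [delta ^ 2]; termwise, the gap is the square [(e - kappa * q) ^ 2 / (2 * kappa)]. *)
Lemma weighted_abs_young {p : nat} (S : 'I_p -> Prop) (g : 'I_p -> R) (q kappa : R) :
  0 < kappa ->
  q * rsum (fun j => ind (S j) *
      Rabs (g j - rsum (fun l => ind (S l) * g l) / rsum (fun l => ind (S l)))) <=
  variation S g / (2 * kappa) + rsum (fun j => ind (S j)) * (q ^ 2 * kappa / 2).
Proof.
move=> k0; set mu := rsum _ / _.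
have -> : variation S g / (2 * kappa) + rsum (fun j => ind (S j)) * (q ^ 2 * kappa / 2) =
    rsum (fun j => ind (S j) * ((g j - mu) ^ 2 / (2 * kappa) + q ^ 2 * kappa / 2)).
  rewrite /variation -/mu /Rdiv Rmult_comm (Rmult_comm (rsum _)) -!rsum_mull -rsum_add.
  by apply: rsum_ext => j; ring.
rewrite -rsum_mull; apply: rsum_le => j.
rewrite (Rmult_comm q) Rmult_assoc; apply: Rmult_le_compat_l; first exact: ind_ge0.
rewrite -(pow2_abs (g j - mu)); set e := Rabs _.
have -> : e ^ 2 / (2 * kappa) + q ^ 2 * kappa / 2 = ((e - kappa * q) ^ 2) / (2 * kappa) + e * q.
  by field; lra.
have : 0 <= (e - kappa * q) ^ 2 / (2 * kappa).
  by apply: Rmult_le_pos; [exact: pow2_ge_0|apply/Rlt_le/Rinv_0_lt_compat; lra].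
lra.
Qed.

Lemma derivable_pt_lim_Rmax0 (h : R -> R) (t l : R) : 0 < t ->
  derivable_pt_lim h t l -> derivable_pt_lim (fun r => h (Rmax 0 r)) t l.
Proof.
move=> t0 /is_derive_Reals dh; apply/is_derive_Reals; apply: is_derive_ext_loc dh.
exists (mkposreal t t0) => r Hr; rewrite Rmax_right //.
have {Hr} /Rabs_lt_between ? : Rabs (r - t) < t by exact: Hr.
lra.
Qed.

Lemma continuity_pt_Rmax0 (h h' : R -> R) : rcont0 h ->
  (forall t, 0 < t -> derivable_pt_lim h t (h' t)) ->
  forall t, continuity_pt (fun r => h (Rmax 0 r)) t.
Proof.
move=> h0 dh t; case: (Rlt_le_dec 0 t) => t0.
  by apply: derivable_continuous_pt; exists (h' t); exact: derivable_pt_lim_Rmax0 (dh t t0).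
move=> eps eps0; have [d [d0 Hd]] := h0 eps eps0.
exists d; split=> // r [_]; rewrite /= /Rdist => /Rabs_lt_between Hr.
rewrite (Rmax_left 0 t) //; apply: Hd; split; first exact: Rmax_l.
by apply: Rmax_lub_lt; lra.
Qed.

Lemma chinorm_variation {N : nat} {m : 'I_N -> nat} (f : costs m) (Rm : Rmats m)
    (G : gvals m) (x xs : vec m) : orthoR f Rm ->
  chinorm f Rm G x xs =
  sqrt (rsum (fun i => rsum (fun k => variation (inS f i k) (fun j => G i j k))) +
        sqnorm (vdiff x xs)).
Proof.
move=> orth; rewrite /chinorm; congr (sqrt (_ + _)); apply: rsum_ext => i; apply: rsum_ext => k.
have [orth1 orth0] := orth i k.
have n0 := nbhd_size_ge1 f i k.
rewrite variationE; last by move: n0; rewrite /nbhd_size; lra.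
apply: projection_sqnorm orth1 orth0 => //.
rewrite lt0n; apply/eqP => E.
have := card_ind (inS f i k); rewrite -/(nS f i k) E /= => E'.
by move: n0; rewrite /nbhd_size -E'; lra.
Qed.

Lemma rsum2_lincomb {N : nat} {m : 'I_N -> nat} (b c d : R) (F G H : vec m) :
  b * rsum (fun i => rsum (F i)) + c * rsum (fun i => rsum (G i)) + d * rsum (fun i => rsum (H i)) =
  rsum (fun i => rsum (fun k => b * F i k + c * G i k + d * H i k)).
Proof.
rewrite -!rsum_mull -!rsum_add; apply: rsum_ext => i.
by rewrite -!rsum_mull -!rsum_add.
Qed.

Section Dynamics.
Context {N : nat} {m : 'I_N -> nat} (f : costs m) (xs : vec m) (dbar : vec m) (df : dercost m).
Context (a : weights m).
Hypothesis A1 : AssumptionA1 f.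
Hypothesis dbar_gt0 : forall i j, 0 < dbar i j.
Hypothesis dfE : forall i j k x, pd (f i j) i k x (df i j k x).
Hypothesis a_ok : weights_ok a.
Hypothesis connected : forall i k, connectedCk f a i k.

Definition disagreement (G : gvals m) : R :=
  rsum (fun i => rsum (fun k => variation (inS f i k) (fun j => G i j k))).

Lemma disagreement_ge0 G : 0 <= disagreement G.
Proof. by apply: rsum_ge0 => i; apply: rsum_ge0 => k; exact: variation_ge0. Qed.

Lemma uniform_poincare : exists kappa, 0 < kappa /\
  forall i k g, variation (inS f i k) g <= kappa * dirichlet (inS f i k) (a i) g.
Proof.
have [a_sym [a_ge0 _]] := a_ok.
pose P (c : @coord N m) K := forall g,
  variation (inS f (tag c) (tagged c)) g <= K * dirichlet (inS f (tag c) (tagged c)) (a (tag c)) g.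
have [||K [K0 HK]] := finite_bound P.
- move=> c K K' KK' H g; apply: Rle_trans (H g) _; apply: Rmult_le_compat_r => //.
  by apply: dirichlet_ge0; exact: a_ge0.
- move=> [i k]; have [|kappa [_ H]] := poincare (inS f i k) (a i) (a_ge0 i) (connected i k).
    by have := nbhd_size_ge1 f i k; rewrite /nbhd_size; lra.
  by exists kappa.
by exists K; split=> // i k g; exact: (HK (mkcoord k)).
Qed.

Lemma uniform_df_speed_bound (B : R) : exists K, 0 < K /\
  forall i j k (X : R -> vec m) (X' : vec m) t M,
    (forall c d, Rabs (X t c d - xs c d) <= B) ->
    (forall c d, derivable_pt_lim (fun r => X r c d) t (X' c d)) ->
    0 <= M -> (forall c d, Rabs (X' c d) <= M) ->
    exists l, derivable_pt_lim (fun r => df i j k (X r)) t l /\ Rabs l <= K * M.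
Proof.
pose I : finType := {i : 'I_N & ('I_(m i) * 'I_(m i))%type}.
pose P (c : I) K := forall (X : R -> vec m) (X' : vec m) t M,
    (forall c d, Rabs (X t c d - xs c d) <= B) ->
    (forall c d, derivable_pt_lim (fun r => X r c d) t (X' c d)) ->
    0 <= M -> (forall c d, Rabs (X' c d) <= M) ->
    exists l, derivable_pt_lim (fun r => df (tag c) (tagged c).1 (tagged c).2 (X r)) t l /\
      Rabs l <= K * M.
have [||K [K0 HK]] := finite_bound P.
- move=> c K K' KK' H X X' t M h1 h2 M0 h3; have [l [dl Hl]] := H X X' t M h1 h2 M0 h3.
  exists l; split=> //; apply: Rle_trans Hl _; exact: Rmult_le_compat_r.
- by move=> [i [j k]]; exact: df_speed_bound A1 dfE i j k B.
exists K; split=> // i j k; exact: (HK (existT _ i (j, k))).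
Qed.

(* Solutions are only right-continuous at [0] and unconstrained at negative times;
   precomposing with [Rmax 0] makes them continuous on the whole line. *)
Definition ext (x : R -> vec m) (t : R) : vec m := x (Rmax 0 t).
Definition energy (x : R -> vec m) (w : R -> gvals m) (t : R) : R :=
  lyap f xs dbar (x (Rmax 0 t)) + disagreement (gof df x w (Rmax 0 t)).

Section Solution.
Context (delta : R) (x : R -> vec m) (w : R -> gvals m).
Hypothesis sol : solution f df a (fun i j => delta * dbar i j) x w.

Lemma ext_continuous t : filterlim (ext x) (locally t) (nb (ext x t)).
Proof.
have [_ [cx [_ [dx _]]]] := sol.
apply: filterlim_vec => i j; apply/continuity_pt_filterlim.
apply: (continuity_pt_Rmax0 (fun r => x r i j)); first exact: cx.
by move=> r r0; exact: dx r r0 i j.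
Qed.

Lemma w_ext_continuous i j k t : inS f i k j ->
  continuity_pt (fun r => w (Rmax 0 r) i j k) t.
Proof.
move=> Sj; have [_ [_ [cw [_ dw]]]] := sol.
apply: (continuity_pt_Rmax0 (fun r => w r i j k)); first exact: cw.
by move=> r r0; exact: dw r r0 i j k Sj.
Qed.

Lemma weighted_sum_w i k t : 0 <= t -> rsum (fun j => ind (inS f i k j) * w t i j k) = 0.
Proof.
move=> t0; have [w0 [_ [cw [_ dw]]]] := sol; have [a_sym [a_ge0 _]] := a_ok.
pose h r := rsum (fun j => ind (inS f i k j) * w (Rmax 0 r) i j k).
have h0 : h 0 = 0.
  rewrite /h /rsum big1 // => j _; rewrite Rmax_left; last exact: Rle_refl.
  case: (classic (inS f i k j)) => Sj; first by rewrite w0 // Rmult_0_r.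
  by rewrite ind_false // Rmult_0_l.
have ch r : continuity_pt h r.
  apply/continuity_pt_filterlim; apply: filterlim_rsum => j.
  case: (classic (inS f i k j)) => Sj.
    apply: filterlim_Rscal; apply/continuity_pt_filterlim; exact: w_ext_continuous.
  rewrite ind_false // Rmult_0_l; apply: (filterlim_ext (fun _ => 0)) => [s|].
    by rewrite Rmult_0_l.
  exact: filterlim_const.
have dh r : 0 < r -> derivable_pt_lim h r 0.
  move=> r0; rewrite -(laplacian_sum0 (inS f i k) (a i) (a_sym i) (fun j => gof df x w r i j k)).
  apply: derivable_pt_lim_rsum => j.
  case: (classic (inS f i k j)) => Sj.
    apply: derivable_pt_lim_scal; apply: (derivable_pt_lim_Rmax0 (fun r => w r i j k)) => //.
    exact: dw.
  rewrite ind_false // Rmult_0_l; apply: (derivable_pt_lim_ext (fun _ => 0)) => [s|].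
    by rewrite Rmult_0_l.
  exact: derivable_pt_lim_const.
have <- : h t = rsum (fun j => ind (inS f i k j) * w t i j k) by rewrite /h Rmax_right.
case: t0 => [t0|<-] //.
have [c [_ E]] := mvt_from_zero h (fun _ => 0) 0 t ch dh (Rle_refl 0) t0.
by lra.
Qed.

Lemma weighted_sum_g i k t : 0 <= t ->
  rsum (fun j => ind (inS f i k j) * gof df x w t i j k) = partial_grad df (x t) i k.
Proof.
move=> t0; rewrite (partial_gradE f df dfE) -[RHS]Rplus_0_l -(weighted_sum_w i k t t0) -rsum_add.
by apply: rsum_ext => j; rewrite /gof; ring.
Qed.

Lemma energy_continuous t : continuity_pt (energy x w) t.
Proof.
apply/continuity_pt_filterlim; have cx := ext_continuous t; apply: filterlim_Rplus.
  by apply: filterlim_comp cx _; exact: lyap_continuous.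
apply: filterlim_rsum => i; apply: filterlim_rsum => k.
apply: filterlim_variation => j Sj; apply: filterlim_Rplus.
  by apply/continuity_pt_filterlim; exact: w_ext_continuous.
by apply: filterlim_comp cx _; exact: df_continuous A1 dfE i j k _.
Qed.

End Solution.

(** The order of the quantifiers matters: [lam] enters the construction of [phi] and must precede
    the sublevel [hi], whereas [C] only limits [delta]. *)
Lemma energy_rate : exists lam, 0 < lam /\ forall hi, exists C, 0 <= C /\
  forall delta x w, 0 < delta <= 1 ->
    solution f df a (fun i j => delta * dbar i j) x w ->
    forall t, 0 < t -> energy x w t < hi ->
    exists l, derivable_pt_lim (energy x w) t l /\
      l <= - delta * (dissipation xs df (x t) + lam * disagreement (gof df x w t)) + delta ^ 2 * C.
Proof.
have [a_sym [a_ge0 _]] := a_ok.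
have [kappa [k0 gap]] := uniform_poincare.
have k2 : 0 < / (2 * kappa) by apply: Rinv_0_lt_compat; lra.
exists (/ (2 * kappa)); split=> // hi.
have [KV [KV0 HKV]] := lyap_coord_bound f xs dbar dbar_gt0.
pose B := 1 + KV * hi.
have [K1 [K10 HK1]] := uniform_df_speed_bound B.
have [||KP [KP0 HKP]] := finite_bound (fun (c : @coord N m) K => forall x,
    (forall i j, Rabs (x i j - xs i j) <= B) -> Rabs (partial_grad df x (tag c) (tagged c)) <= K).
- by move=> c K K' KK' H x Hx; apply: Rle_trans (H x Hx) KK'.
- move=> c; apply: continuous_bounded_on_box => x; exact: (partial_grad_continuous f df A1 dfE).
have [||D [D0 HD]] := finite_bound (fun (c : @coord N m) K => at_coord dbar c <= K).
- by move=> c K K' KK' H; lra.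
- by move=> c; exists (at_coord dbar c); lra.
have [||n [n0 Hn]] := finite_bound (fun (c : @coord N m) K => nbhd_size f (tag c) (tagged c) <= K).
- by move=> c K K' KK' H; lra.
- by move=> c; exists (nbhd_size f (tag c) (tagged c)); lra.
(* [delta * M] bounds the speeds: [D] bounds [dbar], [KP] the mean of the [g]-values (a gradient
   component divided by a size at least 1), and [1 + hi] the deviation from it. *)
pose M := D * (KP + (1 + hi)).
(* [delta * q] collects the coefficients of the absolute deviations: [2 * (K1 * M)] from the forcing
   in [W'], [n * B] from the deviation of [g_ikk] in [V']. *)
pose q := 2 * (K1 * M) + n * B.
exists (rsum (fun i => rsum (fun k => nbhd_size f i k * (q ^ 2 * kappa / 2)))); split.
  apply: rsum_ge0 => i; apply: rsum_ge0 => k; have := nbhd_size_ge1 f i k => ?.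
  apply: Rmult_le_pos; first lra.
  by have := pow2_ge_0 q; nra.
move=> delta x w [d0 d1] sol t t0 Ut.
have tM : Rmax 0 t = t by rewrite Rmax_right; lra.
set G := gof df x w t.
have Ug : lyap f xs dbar (x t) + disagreement G < hi by move: Ut; rewrite /energy tM.
have V0 := lyap_ge0 f xs dbar dbar_gt0 (x t).
have W0 := disagreement_ge0 G.
have Bx i j : Rabs (x t i j - xs i j) <= B by apply: HKV; lra.
have hi0 : 0 < hi by lra.
have B0 : 0 <= B by rewrite /B; nra.
have M0 : 0 <= M by rewrite /M; apply: Rmult_le_pos; lra.
pose mean i k := rsum (fun j => ind (inS f i k j) * G i j k) / nbhd_size f i k.
have meanE i k : mean i k = partial_grad df (x t) i k / nbhd_size f i k.
  by rewrite /mean (weighted_sum_g delta) //; lra.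
have dev_bound i k : Rabs (G i k k - mean i k) <= 1 + hi.
  have H1 : (G i k k - mean i k) ^ 2 <= variation (inS f i k) (fun j => G i j k).
    exact: (variation_ge_term (inS f i k) (fun j => G i j k) k (or_introl erefl)).
  have H2 : variation (inS f i k) (fun j => G i j k) <= disagreement G.
    apply: Rle_trans (rsum_ge_term (fun i => rsum (fun k => variation (inS f i k) (fun j => G i j k))) i _).
      by apply: (rsum_ge_term (fun k => variation (inS f i k) (fun j => G i j k))) => l; exact: variation_ge0.
    by move=> l; apply: rsum_ge0 => ?; exact: variation_ge0.
  rewrite -pow2_abs in H1; have := Rabs_pos (G i k k - mean i k); nra.
have [_ [_ [_ [dx dw]]]] := sol.
pose X' : vec m := fun i j => - (delta * dbar i j) * G i j j.
have dX i j : derivable_pt_lim (fun r => ext x r i j) t (X' i j).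
  by apply: (derivable_pt_lim_Rmax0 (fun r => x r i j)) => //; exact: dx.
have X'bound i j : Rabs (X' i j) <= delta * M.
  rewrite /X' Rabs_mult Rabs_Ropp Rabs_mult (Rabs_right delta); last by lra.
  rewrite Rmult_assoc; apply: Rmult_le_compat_l; first by lra.
  apply: Rmult_le_compat; try exact: Rabs_pos.
    rewrite Rabs_right; first exact: (HD (mkcoord j)).
    by have := dbar_gt0 i j; lra.
  have -> : G i j j = mean i j + (G i j j - mean i j) by ring.
  apply: Rle_trans (Rabs_triang _ _) _; apply: Rplus_le_compat; last exact: dev_bound.
  have n1 := nbhd_size_ge1 f i j.
  rewrite meanE /Rdiv Rabs_mult Rabs_inv (Rabs_right (nbhd_size f i j)); last by lra.
  rewrite -[X in _ <= X]Rmult_1_r; apply: Rmult_le_compat; try exact: Rabs_pos.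
  - by apply/Rlt_le/Rinv_0_lt_compat; lra.
  - exact: (HKP (mkcoord j)).
  - by rewrite -Rinv_1; apply: Rinv_le_contravar; lra.
have dfX i j k : exists l, derivable_pt_lim (fun r => df i j k (ext x r)) t l /\
    Rabs l <= K1 * (delta * M).
  apply: HK1 (dX) _ X'bound; last by apply: Rmult_le_pos; lra.
  by move=> c d; rewrite /ext tM.
pose h i j k := Derive (fun r => df i j k (ext x r)) t.
have dh i j k : derivable_pt_lim (fun r => df i j k (ext x r)) t (h i j k) /\
    Rabs (h i j k) <= K1 * (delta * M).
  have [l [dl Hl]] := dfX i j k.
  by rewrite /h (is_derive_unique _ _ _ (proj2 (is_derive_Reals _ _ _) dl)).
pose g' i j k := - rsum (fun l => ind (inS f i k l) * a i j l * (G i j k - G i l k)) + h i j k.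
have dg i k j : inS f i k j -> derivable_pt_lim (fun r => gof df x w (Rmax 0 r) i j k) t (g' i j k).
  move=> Sj; apply: derivable_pt_lim_plus; last exact: (proj1 (dh i j k)).
  by apply: (derivable_pt_lim_Rmax0 (fun r => w r i j k)) => //; exact: dw.
pose W' i k := 2 * rsum (fun j => ind (inS f i k j) * (G i j k - mean i k) * g' i j k).
pose V' i k := lyap_coef f dbar i k * (2 * (x t i k - xs i k) * X' i k).
exists (rsum (fun i => rsum (fun k => V' i k)) + rsum (fun i => rsum (fun k => W' i k))).
split.
  apply: derivable_pt_lim_plus; apply: derivable_pt_lim_rsum => i; apply: derivable_pt_lim_rsum => k.
    apply: derivable_pt_lim_scal.
    have d1' : derivable_pt_lim (fun r => ext x r i k - xs i k) t (X' i k).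
      rewrite -[X' i k]Rminus_0_r; apply: derivable_pt_lim_minus => //.
      exact: derivable_pt_lim_const.
    have := derivable_pt_lim_mult _ _ _ _ _ d1' d1'.
    rewrite /ext tM (_ : _ + _ = 2 * (x t i k - xs i k) * X' i k); last by ring.
    by apply: derivable_pt_lim_ext => r; rewrite /mult_fct /=; ring.
  have n1 := nbhd_size_ge1 f i k.
  have := derivable_pt_lim_variation (inS f i k) (fun r j => gof df x w (Rmax 0 r) i j k)
    (fun j => g' i j k) t _ (dg i k).
  by rewrite tM; apply; move: n1; rewrite /nbhd_size; lra.
have block i k : V' i k + W' i k <=
    - delta * (vdiff (x t) xs i k * partial_grad df (x t) i k) +
    (- / (2 * kappa) * variation (inS f i k) (fun j => G i j k) +
    delta ^ 2 * (nbhd_size f i k * (q ^ 2 * kappa / 2))).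
  have n1 := nbhd_size_ge1 f i k.
  set y := x t i k - xs i k.
  set E := rsum (fun j => ind (inS f i k j) * Rabs (G i j k - mean i k)).
  have Eterm : Rabs (G i k k - mean i k) <= E.
    rewrite -[X in X <= _]Rmult_1_l -(ind_true (inS f i k k)); last by left.
    apply: (rsum_ge_term (fun j => ind (inS f i k j) * Rabs (G i j k - mean i k))) => j.
    by apply: Rmult_le_pos; [exact: ind_ge0|exact: Rabs_pos].
  (* The mean part of [g_ikk] yields exactly the [(i, k)] term of the dissipation; its deviation
     yields the cross term. *)
  have V'E : V' i k = - delta * (y * partial_grad df (x t) i k) +
      delta * (nbhd_size f i k * (- y * (G i k k - mean i k))).
    have dp := dbar_gt0 i k.
    by rewrite /V' /lyap_coef /X' -/y meanE; field; split; lra.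
  have cross : nbhd_size f i k * (- y * (G i k k - mean i k)) <= n * B * E.
    have e0 := Rabs_pos (G i k k - mean i k).
    have : - y * (G i k k - mean i k) <= B * E.
      apply: Rle_trans (Rle_abs _) _; rewrite Rabs_mult Rabs_Ropp.
      apply: Rmult_le_compat => //; first exact: Rabs_pos.
      exact: Bx.
    have BE : 0 <= B * E by apply: Rmult_le_pos; lra.
    have := Hn (mkcoord k) => /= nk.
    move=> H; apply: Rle_trans (Rmult_le_compat_l _ _ _ _ H) _; first by lra.
    by rewrite Rmult_assoc; apply: Rmult_le_compat_r.
  have rate := perturbed_consensus_rate (inS f i k) (a i) (a_sym i) kappa (K1 * (delta * M)) (mean i k)
    (fun j => G i j k) (fun j => h i j k) k0 (gap i k _) (fun j => proj2 (dh i j k)).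
  have young := weighted_abs_young (inS f i k) (fun j => G i j k) (delta * q) kappa k0.
  rewrite -/(nbhd_size f i k) -/(mean i k) -/E in rate young.
  rewrite -/(W' i k) in rate.
  rewrite /vdiff -/y V'E.
  have cross' : delta * (nbhd_size f i k * (- y * (G i k k - mean i k))) <= delta * (n * B * E).
    by apply: Rmult_le_compat_l; lra.
  have e1 : delta * q * E = 2 * (K1 * (delta * M)) * E + delta * (n * B * E) by rewrite /q; ring.
  rewrite Rpow_mult_distr in young.
  set Wv := variation _ _ in rate young *.
  have e2 : - Wv / kappa = - / (2 * kappa) * Wv - Wv / (2 * kappa) by field; lra.
  lra.
have -> : - delta * (dissipation xs df (x t) + / (2 * kappa) * disagreement G) +
    delta ^ 2 * rsum (fun i => rsum (fun k => nbhd_size f i k * (q ^ 2 * kappa / 2))) =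
  - delta * dissipation xs df (x t) + (- delta * / (2 * kappa)) * disagreement G +
    delta ^ 2 * rsum (fun i => rsum (fun k => nbhd_size f i k * (q ^ 2 * kappa / 2))) by ring.
rewrite /dissipation /inner /disagreement rsum2_lincomb -rsum_add.
apply: rsum_le => i; rewrite -rsum_add; apply: rsum_le => k.
apply: Rle_trans (block i k) _; rewrite Rplus_assoc.
apply: Rplus_le_compat_l; apply: Rplus_le_compat_r.
(* As [delta <= 1], the remaining consensus decay may be slowed down by the factor [delta]. *)
have := variation_ge0 (inS f i k) (fun j => G i j k) => v0.
by apply: Rmult_le_compat_r => //; nra.
Qed.
End Dynamics.

(** * Semi-global practical stability *)

Theorem theorem1 (N : nat) (m : 'I_N -> nat) (f : costs m) (xs : vec m)
    (a : weights m) (dbar : vec m) (Rm : Rmats m) (df : dercost m) :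
  (2 <= N)%nat ->
  (forall i, (2 <= m i)%nat) ->
  AssumptionA1 f -> AssumptionA2 f -> Nash f xs ->
  weights_ok a ->
  (forall i, connectedI f i) ->
  (forall i k, connectedCk f a i k) ->
  (forall i j, 0 < dbar i j) ->
  orthoR f Rm ->
  (forall i j k x, pd (f i j) i k x (df i j k x)) ->
  exists phi : R -> R -> R, classKL phi /\
    forall Delta v, 0 < Delta -> 0 < v ->
      exists dstar, 0 < dstar /\
        forall delta, 0 < delta < dstar ->
          forall (x : R -> vec m) (w : R -> gvals m),
            solution f df a (fun i j => delta * dbar i j) x w ->
            chinorm f Rm (gof df x w 0) (x 0) xs < Delta ->
            forall t, 0 <= t ->
              chinorm f Rm (gof df x w t) (x t) xs
                <= phi (chinorm f Rm (gof df x w 0) (x 0) xs) (delta * t) + v.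
Proof.
move=> _ _ A1 A2 nash a_ok _ conn dbar_gt0 orth dfE.
have [lam [lam0 rate]] := energy_rate f xs dbar df a A1 dbar_gt0 dfE a_ok conn.
have [K [K1 HK]] := lyap_sqnorm f xs dbar dbar_gt0.
have V0 := lyap_ge0 f xs dbar dbar_gt0.
have D0 := dissipation_ge0 f xs df A2 nash dfE.
pose V := lyap f xs dbar; pose D := dissipation xs df.
(* Quantifying over all [x] and all [W >= 0], instead of along solutions, keeps [delta] out of [A].
   The factor 2 reserves half of the decay for the term [delta ^ 2 * C]. *)
pose A u c := forall x W, 0 <= W -> u <= V x + W -> 2 * c <= D x + lam * W.
have A_mono u u' c : u <= u' -> A u c -> A u' c.
  by move=> uu' H x W W0 H1; apply: H => //; lra.
have A_zero u : 0 <= u -> A u 0.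
  by move=> _ x W W0 _; have := D0 x; rewrite -/(D x); nra.
have A_at0 c : A 0 c -> c <= 0.
  move=> H; have := H xs 0 (Rle_refl 0).
  rewrite /V lyap_xs /D /dissipation (inner_partial_grad_xs f) //.
  by move=> /(_ _); rewrite Rplus_0_r => /(_ (Rle_refl 0)); lra.
(* At height [u] or more, [V] or [W] is at least [u / 2]. *)
have A_pos u : 0 < u -> exists c, 0 < c /\ A u c.
  move=> u0; have u2 : 0 < u / 2 by lra.
  have [c [c0 Hc]] := dissipation_lower_bound f xs dbar df A1 A2 nash dbar_gt0 dfE _ u2.
  have lu : 0 < lam * (u / 2) by exact: Rmult_lt_0_compat.
  exists (Rmin c (lam * (u / 2)) / 2); split; first by have := Rmin_pos _ _ c0 lu; lra.
  move=> x W W0 uVW; have := D0 x; rewrite -/(D x) => Dx.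
  have := Rmin_l c (lam * (u / 2)); have := Rmin_r c (lam * (u / 2)).
  case: (Rle_lt_dec (u / 2) (V x)) => [/Hc|Vu]; rewrite -/(D x).
    have : 0 <= lam * W by apply: Rmult_le_pos; lra.
    by lra.
  have : lam * (u / 2) <= lam * W by apply: Rmult_le_compat_l; lra.
  by lra.
have K0 : 0 < K by lra.
have [phi [phiKL Hphi]] := classKL_from_decay A A_mono A_zero A_at0 A_pos K K K0 K0.
exists phi; split=> // Delta v Delta0 v0.
(* An energy of at most [lo] means that the norm of [chi] is at most [v]. *)
pose lo := v ^ 2 / K; have lo0 : 0 < lo by apply: Rdiv_lt_0_compat => //; exact: pow_lt.
have KD0 : 0 <= K * Delta ^ 2 by apply: Rmult_le_pos; [lra|exact: pow2_ge_0].
have [C [C0 HC]] := rate (K * Delta ^ 2 + lo + 1).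
have [c0 [c00 Hc0]] := A_pos lo lo0.
(* The bound 1 is required by [energy_rate]; the other one gives [delta * C <= c0], with [c0] a rate
   admissible at height [lo]. *)
exists (Rmin 1 (c0 / (C + 1))); split.
  by apply: Rmin_pos; [lra|apply: Rdiv_lt_0_compat; lra].
move=> delta [d0 dlt] x w sol chi0 t t0.
have d1 : delta <= 1 by apply: Rlt_le; apply: Rlt_le_trans dlt _; exact: Rmin_l.
have dC : delta * C <= c0.
  have H : delta <= c0 / (C + 1) by apply: Rlt_le; apply: Rlt_le_trans dlt _; exact: Rmin_r.
  have : c0 / (C + 1) * (C + 1) = c0 by field; lra.
  by nra.
set U := energy f xs dbar df x w.
have chiE s : 0 <= s -> 0 <= U s /\
    chinorm f Rm (gof df x w s) (x s) xs <= sqrt (K * U s) /\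
    U s <= K * chinorm f Rm (gof df x w s) (x s) xs ^ 2.
  move=> s0; rewrite chinorm_variation // -/(disagreement f (gof df x w s)).
  have W0 := disagreement_ge0 f (gof df x w s).
  have y0 := sqnorm_ge0 (vdiff (x s) xs).
  rewrite pow2_sqrt; last by lra.
  rewrite /U /energy Rmax_right //; have [H1 H2] := HK (x s); have := V0 (x s) => Vs.
  split; first by lra.
  split; last by nra.
  by apply: sqrt_le_1_alt; nra.
have U0hi : U 0 < K * Delta ^ 2 + lo + 1.
  have [_ [_ H]] := chiE 0 (Rle_refl 0).
  have c00' : 0 <= chinorm f Rm (gof df x w 0) (x 0) xs by exact: sqrt_pos.
  have : chinorm f Rm (gof df x w 0) (x 0) xs ^ 2 <= Delta ^ 2 by apply: pow_incr; lra.
  by nra.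
have hphi0 r s : 0 <= r -> 0 <= s -> 0 <= phi r s.
  move=> r0 s0; have := Hphi r s 0 r0 s0 (Rle_refl 0); rewrite Rmult_0_r sqrt_0; apply.
  move=> c /A_at0 cle; have : 0 <= K * r ^ 2 by apply: Rmult_le_pos; [lra|exact: pow2_ge_0].
  by nra.
have chi00 : 0 <= chinorm f Rm (gof df x w 0) (x 0) xs by exact: sqrt_pos.
have dt0 : 0 <= delta * t by apply: Rmult_le_pos; lra.
have [Us [chis _]] := chiE t t0.
have lohi : lo < K * Delta ^ 2 + lo + 1 by lra.
have cU : forall s, continuity_pt U s := energy_continuous f xs dbar df a A1 dfE delta x w sol.
have dU s : 0 < s -> derivable_pt_lim U s (Derive U s).
  (* Differentiability is needed at all positive times, before [U] is known to stay in the chosen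
     sublevel; hence a level adapted to [U s]. *)
  move=> s0; have [C' [_ HC']] := rate (U s + 1).
  have [|l [dl _]] := HC' delta x w (conj d0 d1) sol s s0; first by rewrite -/U; lra.
  by rewrite (is_derive_unique _ _ _ (proj2 (is_derive_Reals _ _ _) dl)).
have rateU s c : 0 < s -> lo <= U s < K * Delta ^ 2 + lo + 1 -> A (U s) c ->
    Derive U s <= - delta * c.
  move=> s0 [loU Uhi] Ac.
  have [l [dl Hl]] := HC delta x w (conj d0 d1) sol s s0 Uhi.
  rewrite (is_derive_unique _ _ _ (proj2 (is_derive_Reals _ _ _) dl)).
  have Us' : U s = V (x s) + disagreement f (gof df x w s).
    by rewrite /U /energy Rmax_right //; lra.
  have W0 := disagreement_ge0 f (gof df x w s).
  (* The average of [H1] and [H2] bounds the decay below by [c + c0], and [delta * c0] pays for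
     [delta ^ 2 * C]. *)
  have H1 := Ac _ _ W0 (Req_le _ _ Us').
  have H2 := Hc0 (x s) _ W0 (Rle_trans _ _ _ loU (Req_le _ _ Us')).
  rewrite -/(D (x s)) in Hl.
  by nra.
case: (decay_estimate U (Derive U) cU dU A lo _ delta d0 lohi U0hi (A_zero lo (Rlt_le _ _ lo0))
  A_mono rateU t t0) => [Ulo|Udec].
- have : sqrt (K * U t) <= v.
    rewrite -(sqrt_pow2 v); last by lra.
    apply: sqrt_le_1_alt; have : K * lo = v ^ 2 by rewrite /lo; field; lra.
    by nra.
  by have := hphi0 _ _ chi00 dt0; lra.
- have := Hphi _ _ (U t) chi00 dt0 Us _.
  suff H : forall c, A (U t) c ->
      U t + delta * t * c <= K * chinorm f Rm (gof df x w 0) (x 0) xs ^ 2.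
    by move=> /(_ H); lra.
  by move=> c /Udec; have [_ [_ H]] := chiE 0 (Rle_refl 0); lra.
Qed.
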